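(* Let $\mu$ be a regular Borel probability measure on $\mathbb{S}^{d-1}$ whose support $G$ satisfies: (C1) the open half-spaces $H_u$ with $u\in G$ cover $\mathbb{S}^{d-1}$, and (C2) the reflections $\{R_u\mid u\in G\}$ generate a dense subgroup of $O(d)$. For Borel measures $\nu$ on $\mathbb{S}^{d-1}$ define $$T_\mu\#\nu\,(A)=\int_{\mathbb{S}^{d-1}}\nu(F_u^{-1}(A))\,d\mu(u)\qquad (A\subset\mathbb{S}^{d-1}\text{ Borel}).$$ Then there is a unique regular Borel probability measure $\rho$ on $\mathbb{S}^{d-1}$ with $T_\mu\#\rho=\rho$, and the support of $\rho$ is the entire sphere $\mathbb{S}^{d-1}$.
   Context: $\mathbb{S}^{d-1}$ is the set of unit vectors in $\mathbb{R}^d$; $O(d)$ is the group of orthogonal linear transformations of $\mathbb{R}^d$. For $u\in\mathbb{S}^{d-1}$: $R_u x=x-2(x\cdot u)u$; $H_u=\{x\in\mathbb{R}^d\mid x\cdot u>0\}$; the folding map is $F_u(x)=x$ if $x\in H_u$ and $F_u(x)=R_ux$ otherwise, here regarded as a map of $\mathbb{S}^{d-1}$ to itself. The support of a measure is the smallest closed subset of full measure. *)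

(* Defs.v *)
From HB Require Import structures.
From mathcomp Require Import all_boot all_order all_algebra.
From mathcomp Require Import all_classical all_reals all_analysis.
From mathcomp Require Import ring.

Set Implicit Arguments.
Unset Strict Implicit.
Unset Printing Implicit Defensive.

Import Order.TTheory GRing.Theory Num.Theory.
Import numFieldNormedType.Exports.
Local Open Scope classical_set_scope.
Local Open Scope ring_scope.

(* The library norm on 'rV[R]_m is the sup norm: it induces the usual topology,
   but the Euclidean structure has to come from [dot]. *)

Section euclidean.
Context {R : realType} {m : nat}.
Implicit Types x y u : 'rV[R]_m.

Definition dot x y : R := (x *m y^T) 0 0.

Definition refl u x : 'rV[R]_m := x - (2 * dot x u) *: u.

Definition halfspace u : set 'rV[R]_m := [set x | 0 < dot x u].

Definition fold u x : 'rV[R]_m := if x \in halfspace u then x else refl u x.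

Definition orthogonal_mx : set 'M[R]_m := [set A | A *m A^T = 1%:M].

Definition orthogonal_subgroup (H : set 'M[R]_m) : Prop :=
  [/\ H `<=` orthogonal_mx,
      H 1%:M,
      (forall A B, H A -> H B -> H (A *m B)) &
      (forall A, H A -> H (invmx A))].

(* Only meaningful for X `<=` orthogonal_mx: otherwise the intersection
   underlying [smallest] ranges over the empty family. *)
Definition generated_subgroup (X : set 'M[R]_m) : set 'M[R]_m :=
  smallest orthogonal_subgroup X.

(* The matrix of refl u in the convention where A acts by x |-> x *m A. *)
Definition refl_mx u : 'M[R]_m := lin1_mx (refl u).

Lemma dotC x y : dot x y = dot y x.
Proof.
by rewrite /dot !mxE; apply: eq_bigr => k _; rewrite !mxE mulrC.
Qed.

Lemma dotDl x y u : dot (x + y) u = dot x u + dot y u.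
Proof. by rewrite /dot mulmxDl mxE. Qed.

Lemma dotZl a x u : dot (a *: x) u = a * dot x u.
Proof. by rewrite /dot -scalemxAl mxE. Qed.

Lemma refl_is_linear u : linear (refl u).
Proof.
move=> a x y; rewrite /refl dotDl dotZl scalerBr scalerA mulrDr scalerDl.
by rewrite mulrCA opprD addrACA.
Qed.

HB.instance Definition _ u :=
  GRing.isLinear.Build R 'rV[R]_m 'rV[R]_m *:%R (refl u) (refl_is_linear u).

Lemma mul_refl_mx u x : x *m refl_mx u = refl u x.
Proof. exact: mul_rV_lin1. Qed.

Lemma dot_refl u x y : dot u u = 1 -> dot (refl u x) (refl u y) = dot x y.
Proof.
move=> u1.
have E z c w : dot (z - c *: u) w = dot z w - c * dot u w.
  by rewrite -scaleNr dotDl dotZl mulNr.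
rewrite /refl E (dotC x) (dotC u) !E u1 (dotC u x) (dotC y x); ring.
Qed.

Lemma refl_mx_orthogonal u : dot u u = 1 -> orthogonal_mx (refl_mx u).
Proof.
move=> u1; apply/matrixP => i j.
have E (k : 'I_m) : row k (refl_mx u) = refl u (delta_mx 0 k).
  by rewrite -mul_refl_mx -rowE.
have -> : (refl_mx u *m (refl_mx u)^T) i j =
    dot (row i (refl_mx u)) (row j (refl_mx u)).
  by rewrite /dot !mxE; apply: eq_bigr => k _; rewrite !mxE.
rewrite !E (dot_refl _ _ u1) /dot trmx_delta mul_delta_mx_cond !mxE.
by case: eqVneq => _; rewrite ?mulr1n ?mulr0n ?mxE.
Qed.

Lemma dot_fold u x : dot u u = 1 -> dot (fold u x) (fold u x) = dot x x.
Proof. by move=> u1; rewrite /fold; case: ifP => // _; exact: dot_refl. Qed.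

End euclidean.

(* The unit sphere of R^(n+1): with d = n.+1 it is S^(d-1), and d ranges over
   all positive dimensions. *)
Definition unit_sphere (R : realType) (n : nat) : set 'rV[R]_n.+1 :=
  [set x | dot x x = 1].
Arguments unit_sphere : clear implicits.

Definition sphere (R : realType) (n : nat) : Type :=
  set_type (unit_sphere R n).

Lemma unit_sphere_delta (R : realType) (n : nat) :
  (delta_mx 0 0 : 'rV[R]_n.+1) \in unit_sphere R n.
Proof.
by apply/mem_set; rewrite /unit_sphere /= /dot trmx_delta mul_delta_mx mxE.
Qed.

(* The subspace topology inherited from 'rV[R]_n.+1. *)
HB.instance Definition _ (R : realType) (n : nat) :=
  Topological.copy (sphere R n) (set_type (unit_sphere R n)).
HB.instance Definition _ (R : realType) (n : nat) :=
  isPointed.Build (sphere R n)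
    (SigSub (unit_sphere_delta R n) : set_type (unit_sphere R n)).

(* The Borel sigma-algebra; a measure mu is a function on all subsets of the
   sphere whose values carry meaning only on these measurable sets. *)
HB.instance Definition _ (R : realType) (n : nat) :=
  Measurable.copy (sphere R n) (g_sigma_algebraType (@open (sphere R n))).

Section sphere.
Context {R : realType} {n : nat}.
Local Notation S := (sphere R n).
Implicit Types (u x : S).

Lemma dot_sphere x : dot (val x) (val x) = 1.
Proof. exact: set_mem (valP x). Qed.

Lemma fold_sphere u x : fold (val u) (val x) \in unit_sphere R n.
Proof.
by apply/mem_set; rewrite /unit_sphere /= dot_fold dot_sphere.
Qed.

Definition sfold u x : S :=
  (SigSub (fold_sphere u x) : set_type (unit_sphere R n)).

Definition T_push (mu nu : {measure set S -> \bar R}) (A : set S) : \bar R :=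
  (\int[mu]_u nu (sfold u @^-1` A))%E.

End sphere.

Definition regular_measure {R : realType} {n : nat}
    (mu : {measure set (sphere R n) -> \bar R}) : Prop :=
  forall A, measurable A ->
    mu A = ereal_inf [set mu U | U in [set U | open U /\ A `<=` U]] /\
    mu A = ereal_sup [set mu K | K in [set K | compact K /\ K `<=` A]].

Definition is_support {R : realType} {n : nat}
    (mu : {measure set (sphere R n) -> \bar R}) (G : set (sphere R n)) : Prop :=
  [/\ closed G, mu (~` G) = 0%E &
      forall F, closed F -> mu (~` F) = 0%E -> G `<=` F].

(* Main.v *)
Require Import Defs.
From HB Require Import structures.
From mathcomp Require Import all_boot all_order all_algebra.
From mathcomp Require Import all_classical all_reals all_analysis.
From mathcomp Require Import measurable_realfun ring lra.

(* Both S^(d-1) and O(d) carry a lazy random walk driven by mu: stay put or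
   apply the fold (on O(d), multiply by the reflection) in a mu-random
   direction. The steps are 1-Lipschitz for the Euclidean metric, so as soon as
   every open set is reachable from every point, a Doeblin argument shows that
   the iterates of a Lipschitz function converge uniformly to a constant; this
   constant is a positive functional of the function.

   On O(d) reachability is the density hypothesis, and the limit functional,
   which commutes with right translations, gives an O(d)-invariant mean on the
   sphere. With it one proves rigidity: a Lipschitz function psi that
   no fold F_u, u in G, can increase is constant. Applied to the supremum of a
   bump function over the points reachable from x, rigidity yields reachability
   for the folds. The limit functional of the fold walk is then
   represented by a regular measure rho (Riesz); rho is stationary, every
   stationary measure has the same means of Lipschitz functions, and strict
   positivity of the functional gives full support. *)

(** A fold is not injective, so reachability under folds is not symmetric and the density of a
    reflection group says nothing about it directly. On O(d), by contrast, every step is undone by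
    repeating it, so the points reachable from [g] form a coset of the generated subgroup, which is
    dense. This is why the argument visits O(d) before the sphere. Laziness removes a parity
    obstruction: reflections have determinant -1, so the plain walk on O(d) alternates between the
    two components and its iterates need not converge. Replacing the step T by (1 + T) / 2 leaves
    the stationary measures unchanged. Lipschitz functions, rather than continuous ones, are the
    test functions because 1-Lipschitz steps preserve the Lipschitz constant: a single bump function
    and a single minorization constant then contract the oscillation of all iterates of a given
    function. *)

Set Implicit Arguments.
Unset Strict Implicit.
Unset Printing Implicit Defensive.

Import Order.TTheory GRing.Theory Num.Theory.
Import numFieldNormedType.Exports.
Local Open Scope classical_set_scope.
Local Open Scope ring_scope.

(** * Euclidean metric *)

Section euclidean_metric.
Context {R : realType} {m : nat}.
Implicit Types x y z u v : 'rV[R]_m.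

Lemma dotE x y : dot x y = \sum_i x 0 i * y 0 i.
Proof. by rewrite /dot mxE; apply: eq_bigr => i _; rewrite mxE. Qed.

Lemma dotDr x y z : dot x (y + z) = dot x y + dot x z.
Proof. by rewrite !(dotC x) dotDl. Qed.

Lemma dotZr a x y : dot x (a *: y) = a * dot x y.
Proof. by rewrite !(dotC x) dotZl. Qed.

Lemma dotNl x y : dot (- x) y = - dot x y.
Proof. by rewrite -scaleN1r dotZl mulN1r. Qed.

Lemma dotNr x y : dot x (- y) = - dot x y.
Proof. by rewrite !(dotC x) dotNl. Qed.

Definition dot_lin := (@dotDl R m, dotDr, dotNl, dotNr, @dotZl R m, dotZr).

Lemma dot_ge0 x : 0 <= dot x x.
Proof. by rewrite dotE sumr_ge0// => i _; rewrite -expr2 sqr_ge0. Qed.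

Lemma sqr_coord_le x i : x 0 i ^+ 2 <= dot x x.
Proof.
rewrite dotE (bigD1 i)//= expr2 lerDl sumr_ge0// => j _.
by rewrite -expr2 sqr_ge0.
Qed.

Lemma dot_eq0 x : dot x x = 0 -> x = 0.
Proof.
move=> x0; apply/rowP => i; rewrite mxE; apply/eqP; rewrite -sqrf_eq0.
by rewrite eq_le sqr_ge0 andbT -x0 sqr_coord_le.
Qed.

Lemma CauchySchwarz x y : dot x y ^+ 2 <= dot x x * dot y y.
Proof.
have [y0|y0] := eqVneq (dot y y) 0.
  by rewrite (dot_eq0 y0) -(scale0r 0) !dotZr !mul0r expr0n mulr0.
have y_gt0 : 0 < dot y y by rewrite lt_def y0 dot_ge0.
have := dot_ge0 (dot y y *: x - dot x y *: y).
rewrite !dot_lin (dotC y x).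
set a := dot x x; set b := dot y y in y0 y_gt0 *; set c := dot x y => H.
rewrite -subr_ge0 -(pmulr_rge0 _ y_gt0).
by apply: (le_trans H); rewrite le_eqVlt; apply/orP; left; apply/eqP; ring.
Qed.

Definition enorm x : R := Num.sqrt (dot x x).

Lemma enorm_ge0 x : 0 <= enorm x. Proof. exact: sqrtr_ge0. Qed.

Lemma sqr_enorm x : enorm x ^+ 2 = dot x x.
Proof. by rewrite sqr_sqrtr ?dot_ge0. Qed.

Lemma enorm0 : enorm 0 = 0.
Proof. by rewrite /enorm -(scale0r 0) dotZl mul0r sqrtr0. Qed.

Lemma enorm1 x : dot x x = 1 -> enorm x = 1.
Proof. by rewrite /enorm => ->; rewrite sqrtr1. Qed.

Lemma enorm_eq0 x : enorm x = 0 -> x = 0.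
Proof. by move=> x0; apply: dot_eq0; rewrite -sqr_enorm x0 expr0n. Qed.

Lemma ler_enorm x y : dot x x <= dot y y -> enorm x <= enorm y.
Proof. exact: ler_wsqrtr. Qed.

Lemma enormZ a x : enorm (a *: x) = `|a| * enorm x.
Proof.
by rewrite /enorm dotZl dotZr mulrA -expr2 sqrtrM ?sqr_ge0// sqrtr_sqr.
Qed.

Lemma enormN x : enorm (- x) = enorm x.
Proof. by rewrite -scaleN1r enormZ normrN1 mul1r. Qed.

Lemma normr_dot_le x y : `|dot x y| <= enorm x * enorm y.
Proof.
rewrite -ler_sqr ?nnegrE ?mulr_ge0 ?enorm_ge0// real_normK ?num_real//.
by rewrite exprMn !sqr_enorm CauchySchwarz.
Qed.

Lemma enormD x y : enorm (x + y) <= enorm x + enorm y.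
Proof.
rewrite -ler_sqr ?nnegrE ?addr_ge0 ?enorm_ge0//.
rewrite sqrrD !sqr_enorm !dot_lin (dotC y x).
have := le_trans (ler_norm _) (normr_dot_le x y).
lra.
Qed.

Lemma coord_le_enorm x i : `|x 0 i| <= enorm x.
Proof.
rewrite -ler_sqr ?nnegrE ?enorm_ge0// real_normK ?num_real//.
by rewrite sqr_enorm sqr_coord_le.
Qed.

Definition eucdist x y := enorm (x - y).

Lemma eucdist_ge0 x y : 0 <= eucdist x y. Proof. exact: enorm_ge0. Qed.

Lemma eucdistxx x : eucdist x x = 0. Proof. by rewrite /eucdist subrr enorm0. Qed.

Lemma eucdistC x y : eucdist x y = eucdist y x.
Proof. by rewrite /eucdist -enormN opprB. Qed.

Lemma eucdist_triangle y x z : eucdist x z <= eucdist x y + eucdist y z.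
Proof. by rewrite /eucdist (le_trans _ (enormD _ _))// addrA subrK. Qed.

(** The branches agree on the hyperplane [dot x u = 0]. This single formula exposes the continuity
    in [u] and [x]; both Lipschitz bounds below are computed from it. *)
Lemma foldE u x : fold u x = x + (2 * Num.max 0 (- dot x u)) *: u.
Proof.
rewrite /fold; case: ifPn => [/set_mem xu|/negP xu].
  have xu0 : 0 < dot x u := xu.
  by rewrite (max_idPl _) ?mulr0 ?scale0r ?addr0// oppr_le0 ltW.
have xu0 : dot x u <= 0 by rewrite leNgt; apply/negP => ?; exact/xu/mem_set.
by rewrite /refl (max_idPr _) ?oppr_ge0// mulrN scaleNr.
Qed.

(** Points on the same side keep their distance; if the hyperplane separates them, moving one to the
    side of the other can only shorten it. *)
Lemma fold_eucdist u x y : dot u u = 1 ->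
  eucdist (fold u x) (fold u y) <= eucdist x y.
Proof.
move=> u1; apply: ler_enorm; rewrite !foldE opprD addrACA -scalerBl.
have E a s : dot (a + s *: u) (a + s *: u) = dot a a + 2 * s * dot a u + s ^+ 2.
  by rewrite !dot_lin u1 (dotC u a); ring.
rewrite E !dot_lin.
have [?|?] := leP 0 (- dot x u); have [?|?] := leP 0 (- dot y u); nra.
Qed.

(** The 4 is 2 + 2: the coefficient [s], at most 1 on the sphere, multiplies [u - v], and [s - t] is
    bounded by the same distance because the positive part is 1-Lipschitz. *)
Lemma fold_eucdist_dir u v x : dot v v = 1 -> dot u u = 1 -> dot x x = 1 ->
  eucdist (fold u x) (fold v x) <= 4 * eucdist u v.
Proof.
move=> v1 u1 x1; rewrite !foldE /eucdist.
set s := Num.max 0 (- dot x u); set t := Num.max 0 (- dot x v).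
have -> : x + 2 * s *: u - (x + 2 * t *: v) =
    (2 * s) *: (u - v) + (2 * (s - t)) *: v.
  by apply/rowP => i; rewrite !mxE; ring.
have xu := normr_dot_le x u; have xuv := normr_dot_le x (u - v).
rewrite (enorm1 x1) (enorm1 u1) mulr1 in xu.
rewrite (enorm1 x1) mul1r dotDr dotNr in xuv.
apply: le_trans (enormD _ _) _; rewrite !enormZ (enorm1 v1) mulr1 !normrM.
rewrite normr_nat.
have s1 : `|s| <= 1.
  by move: xu; rewrite !ler_norml /s; have [?|?] := leP 0 (- dot x u); lra.
have st : `|s - t| <= enorm (u - v).
  move: xuv; rewrite !ler_norml /s /t.
  by have [?|?] := leP 0 (- dot x u); have [?|?] := leP 0 (- dot x v); lra.
have := enorm_ge0 (u - v); have := normr_ge0 s; nra.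
Qed.

End euclidean_metric.

(** * Euclidean topology and compactness *)

Section euclidean_topology.
Context {R : realType} {m : nat}.
Implicit Types x y : 'rV[R]_m.

(** The crude factor [m.+1], instead of the square root of [m], keeps the inequality strict when [m]
    is 0. *)
Lemma eucdist_lt_coord x y e : 0 < e -> (forall i, `|x 0 i - y 0 i| < e) ->
  eucdist x y < m.+1%:R * e.
Proof.
move=> e0 xye.
rewrite -ltr_sqr ?nnegrE ?enorm_ge0 ?mulr_ge0 ?ltW// sqr_enorm dotE.
apply: (@le_lt_trans _ _ (\sum_(i < m) e ^+ 2)).
  apply: ler_sum => i _; rewrite -expr2 -real_normK ?num_real// !mxE.
  by rewrite ler_sqr ?nnegrE ?(ltW e0)// ltW// xye.
rewrite sumr_const card_ord -[ltLHS]mulr_natl exprMn ltr_pM2r ?exprn_gt0//.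
by rewrite -natrX ltr_nat -mulnn (leq_trans (ltnSn m))// leq_pmulr.
Qed.

Lemma nbhs_eucdist x (A : set 'rV[R]_m) :
  nbhs x A <-> exists2 r, 0 < r & forall y, eucdist x y < r -> A y.
Proof.
split=> [/nbhs_ballP[r /= r0 rA]|[r r0 rA]].
  exists r => // y xyr; apply: rA; split => // i j; rewrite (ord1 i).
  by have := le_lt_trans (coord_le_enorm (x - y) j) xyr; rewrite !mxE.
apply/nbhs_ballP; exists (r / m.+1%:R) => /=; first by rewrite divr_gt0.
move=> y [_ xyr]; apply: rA.
apply: lt_le_trans (eucdist_lt_coord _ (xyr 0)) _; first by rewrite divr_gt0.
by rewrite mulrC divfK.
Qed.

(** The sets [U k] need only be increasing and relatively open on [K]. The near-covering form of
    compactness, along the filter of large [k], returns one index for all points. *)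
Lemma compact_increasing_cover (K : set 'rV[R]_m) (U : nat -> set 'rV[R]_m) :
  compact K ->
  (forall k x, K x -> U k x -> U k.+1 x) ->
  (forall k x, K x -> U k x ->
    exists2 r, 0 < r & forall y, K y -> eucdist x y < r -> U k y) ->
  (forall x, K x -> exists k, U k x) ->
  exists k, K `<=` U k.
Proof.
move=> /compact_near_coveringP cK Uincr Uopen Ucov.
have Umono j k x : (j <= k)%N -> K x -> U j x -> U k x.
  move=> /subnK <- Kx; elim: (k - j)%N => // d IH /IH; exact: Uincr.
have : \forall k \near \oo, K `<=` (fun y => K y -> U k y).
  apply: cK => x Kx.
  have [k Ukx] := Ucov x Kx; have [r r0 rU] := Uopen k x Kx Ukx.
  exists ([set y | eucdist x y < r], [set j | (k <= j)%N]) => /=.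
    split; last by exists k.
    by apply: (nbhs_eucdist x _).2; exists r.
  by case=> y j /= [xyr kj] Ky; exact: (Umono _ _ _ kj Ky (rU y Ky xyr)).
by case=> N _ NU; exists N => x Kx; exact: (NU N (leqnn N) x Kx Kx).
Qed.

End euclidean_topology.

Lemma compact_unit_sphere (R : realType) n : compact (unit_sphere R n).
Proof.
apply: bounded_closed_compact.
  exists 1; split => // e e1 x /= x1; apply: ltW; apply: le_lt_trans e1.
  rewrite [leLHS]/Num.norm/= mx_normrE; apply/bigmax_leP; split => //= -[i j] _ /=.
  by rewrite (ord1 i) (le_trans (coord_le_enorm x j))// (enorm1 x1).
have -> : unit_sphere R n = (fun x => \sum_i x 0 i * x 0 i) @^-1` [set 1].
  by apply/seteqP; split => x; rewrite /unit_sphere /= dotE.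
apply: preimage_closed; last exact: closed_eq.
move=> x _; apply: continuous_big; first exact: add_continuous.
by move=> i _ y; apply: continuousM; exact: coord_continuous.
Qed.

(** Flattening turns the Frobenius inner product into [dot], so O(d) becomes a compact set of row
    vectors and is handled like the sphere. *)
Lemma dot_mxvec (R : realType) m n (A B : 'M[R]_(m, n)) :
  dot (mxvec A) (mxvec B) = \tr (A *m B^T).
Proof.
rewrite dotE (reindex _ (curry_mxvec_bij _ _)) /= /mxtrace.
under [RHS]eq_bigr do rewrite mxE.
rewrite pair_bigA /=; apply: eq_bigr => -[i j] _ /=.
by rewrite !mxvecE !mxE.
Qed.

Lemma compact_orthogonal_mx (R : realType) n :
  compact [set mxvec A | A in @orthogonal_mx R n].
Proof.
apply: bounded_closed_compact.
  exists (Num.sqrt n%:R); split; first exact: num_real.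
  move=> e e1 x /= [A AA <-]; apply: ltW; apply: le_lt_trans e1.
  rewrite [leLHS]/Num.norm/= mx_normrE; apply/bigmax_leP; split => //= -[i j] _ /=.
  rewrite (ord1 i) (le_trans (coord_le_enorm _ j))//.
  by rewrite /enorm dot_mxvec AA mxtrace1.
have -> : [set mxvec A | A in @orthogonal_mx R n] =
    \bigcap_ij ((fun x : 'rV[R]_(n * n) =>
      \sum_k vec_mx x ij.1 k * vec_mx x ij.2 k) @^-1` [set (ij.1 == ij.2)%:R]).
  apply/seteqP; split=> [_ [A AA <-] [i j] _ /=|x xo].
    rewrite mxvecK; move/matrixP/(_ i j) : AA; rewrite !mxE => <-.
    by apply: eq_bigr => k _; rewrite [_^T _ _]mxE.
  exists (vec_mx x); last by rewrite vec_mxK.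
  apply/matrixP => i j; have := xo (i, j) I; rewrite /= !mxE => <-.
  by apply: eq_bigr => k _; rewrite [_^T _ _]mxE.
apply: closed_bigI => ij _; apply: preimage_closed; last exact: closed_eq.
move=> x _; apply: continuous_big; first exact: add_continuous.
move=> k _ y; rewrite (_ : (fun _ => _) = fun x : 'rV[R]_(n * n) =>
  x 0 (mxvec_index ij.1 k) * x 0 (mxvec_index ij.2 k)).
  by apply: continuousM; exact: coord_continuous.
by apply/funext => z; rewrite !mxE.
Qed.

(** * Lipschitz functions and their means *)

Section lipschitz.
Context {R : realType} {X : Type} {m : nat} (iota : X -> 'rV[R]_m).
Implicit Types (f g : X -> R) (K L : R) (x y : X).
Local Notation D x y := (eucdist (iota x) (iota y)).

(** In the applications [X] is the sphere with [val], or O(d) with flattened matrices; [iota] pulls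
    back the Euclidean metric, so one theory serves both walks. *)
Definition klip K f := forall x y, `|f x - f y| <= K * D x y.
Definition lip f := exists K, klip K f.

Lemma klip_weaken K L f : K <= L -> klip K f -> klip L f.
Proof.
by move=> KL Kf x y; rewrite (le_trans (Kf x y))// ler_wpM2r// eucdist_ge0.
Qed.

Lemma lip_klip f : lip f -> exists2 K, 0 < K & klip K f.
Proof.
case=> K Kf; exists (Num.max 1 K); first by rewrite lt_max ltr01.
by apply: klip_weaken Kf; rewrite le_max lexx orbT.
Qed.

Lemma klipP K f : (forall x y, f x <= f y + K * D x y) -> klip K f.
Proof.
move=> Kf x y; have := Kf x y; have := Kf y x.
by rewrite (eucdistC (iota y)) ler_norml => ? ?; apply/andP; split; lra.
Qed.

Lemma klip_le K f x y : klip K f -> f x <= f y + K * D x y.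
Proof. by move=> /(_ x y); rewrite ler_norml => /andP[_]; rewrite lerBlDl. Qed.

Lemma klip_cst c : klip 0 (fun=> c).
Proof. by move=> x y; rewrite subrr normr0 mul0r. Qed.

Lemma lip_cst c : lip (fun=> c). Proof. by exists 0; exact: klip_cst. Qed.

Lemma lipD f g : lip f -> lip g -> lip (fun x => f x + g x).
Proof.
move=> [K Kf] [L Lg]; exists (K + L) => x y.
by rewrite opprD addrACA (le_trans (ler_normD _ _))// mulrDl lerD.
Qed.

Lemma lipZ a f : lip f -> lip (fun x => a * f x).
Proof.
move=> [K Kf]; exists (`|a| * K) => x y.
by rewrite -mulrBr normrM -mulrA ler_wpM2l.
Qed.

Lemma lipB f g : lip f -> lip g -> lip (fun x => f x - g x).
Proof.
move=> lf lg; under eq_fun do rewrite -mulN1r.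
by apply: lipD => //; exact: lipZ.
Qed.

Lemma lip_sum (I : Type) (r : seq I) (F : I -> X -> R) :
  (forall i, lip (F i)) -> lip (fun x => \sum_(i <- r) F i x).
Proof.
move=> lF; elim: r => [|i r IH].
  by under eq_fun do rewrite big_nil; exact: lip_cst.
by under eq_fun do rewrite big_cons; exact: lipD.
Qed.

Lemma lip_max f g : lip f -> lip g -> lip (fun x => Num.max (f x) (g x)).
Proof.
move=> [K Kf] [L Lg]; exists (`|K| + `|L|); apply: klipP => x y.
have := klip_le x y (klip_weaken (ler_norm K) Kf).
have := klip_le x y (klip_weaken (ler_norm L) Lg).
have := eucdist_ge0 (iota x) (iota y); rewrite mulrDl.
have := normr_ge0 K; have := normr_ge0 L.
set a := `|K|; set b := `|L|; set d := eucdist _ _ => a0 b0 d0.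
have := mulr_ge0 a0 d0; have := mulr_ge0 b0 d0.
have [?|?] := leP (f x) (g x); have [?|?] := leP (f y) (g y); lra.
Qed.

Lemma lip_min f g : lip f -> lip g -> lip (fun x => Num.min (f x) (g x)).
Proof.
move=> lf lg; rewrite (_ : (fun _ => _) =
    fun x => -1 * Num.max (-1 * f x) (-1 * g x)).
  by apply/lipZ/lip_max; exact: lipZ.
by apply/funext => x; rewrite !mulN1r oppr_max !opprK.
Qed.

Lemma klip_dist z : klip 1 (fun x => eucdist (iota x) z).
Proof. by apply: klipP => x y; rewrite mul1r addrC eucdist_triangle. Qed.

Lemma lip_dot z : lip (fun x => dot (iota x) z).
Proof.
exists (enorm z) => x y; rewrite -dotNl -dotDl mulrC.
exact: normr_dot_le.
Qed.

Section bounded.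
Variable B : R.
Hypothesis iotaB : forall x, enorm (iota x) <= B.

Lemma lip_bounded f : lip f -> exists2 M, 0 < M & forall x, `|f x| <= M.
Proof.
move=> /lip_klip[K K0 Kf].
(* [X] may be empty, in which case any bound will do. *)
have [[x0 _]|] := pselect (exists x : X, True); last first.
  by move=> nX; exists 1 => // x; exfalso; apply: nX; exists x.
exists (`|f x0| + K * (B + B) + 1) => [|x].
  have := enorm_ge0 (iota x0); have := iotaB x0 => h1 h2.
  by rewrite ltr_wpDl// addr_ge0// mulr_ge0 ?(ltW K0)//; lra.
have := Kf x x0; have : D x x0 <= B + B.
  by rewrite (le_trans (enormD _ _))// enormN lerD.
move=> DB; have := ler_wpM2l (ltW K0) DB.
have := ler_normD (f x0) (f x - f x0); rewrite addrC subrK.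
lra.
Qed.

Lemma lipM f g : lip f -> lip g -> lip (fun x => f x * g x).
Proof.
move=> lf lg; have [M M0 fM] := lip_bounded lf; have [N N0 gN] := lip_bounded lg.
case: lf => K Kf; case: lg => L Lg; exists (M * L + N * K) => x y.
have -> : f x * g x - f y * g y = f x * (g x - g y) + g y * (f x - f y) by ring.
rewrite (le_trans (ler_normD _ _))// !normrM mulrDl -!mulrA.
by rewrite lerD// ler_pM.
Qed.

End bounded.

(* Capped at 1 so that it also makes sense when U is the whole space. *)
Definition setdist (U : set X) x : R :=
  inf [set r | r = 1 \/ exists2 y, ~ U y & r = D x y].

Lemma setdist_has_inf (U : set X) x :
  has_inf [set r | r = 1 \/ exists2 y, ~ U y & r = D x y].
Proof.
by split; [exists 1; left|exists 0 => _ [->//|[y _ ->]]; exact: eucdist_ge0].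
Qed.

Lemma setdist_ge0 U x : 0 <= setdist U x.
Proof.
apply: lb_le_inf; first exact: (setdist_has_inf U x).1.
by move=> _ [->//|[y _ ->]]; exact: eucdist_ge0.
Qed.

Lemma setdist0 (U : set X) x : ~ U x -> setdist U x = 0.
Proof.
move=> Ux; apply/eqP; rewrite eq_le setdist_ge0 andbT.
apply: ge_inf; first exact: (setdist_has_inf U x).2.
by right; exists x => //; rewrite eucdistxx.
Qed.

Lemma setdist_gt0 (U : set X) x r : 0 < r -> (forall y, D x y < r -> U y) ->
  0 < setdist U x.
Proof.
move=> r0 rU; apply: (@lt_le_trans _ _ (Num.min 1 r)).
  by rewrite lt_min ltr01.
apply: lb_le_inf; first exact: (setdist_has_inf U x).1.
move=> _ [->|[y Uy ->]]; rewrite ge_min ?lexx//.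
by apply/orP; right; rewrite leNgt; apply/negP => /rU.
Qed.

Lemma klip_setdist U : klip 1 (setdist U).
Proof.
apply: klipP => x y; rewrite mul1r -lerBlDr.
apply: lb_le_inf; first exact: (setdist_has_inf U y).1.
have ge_x r : r = 1 \/ (exists2 y, ~ U y & r = D x y) -> setdist U x <= r.
  by move=> h; apply: ge_inf => //; exact: (setdist_has_inf U x).2.
move=> _ [->|[z Uz ->]]; rewrite lerBlDr.
  by rewrite (le_trans (ge_x 1 _)) ?lerDl ?eucdist_ge0//; left.
rewrite addrC (le_trans _ (eucdist_triangle _ _ _))//.
by apply: ge_x; right; exists z.
Qed.

End lipschitz.
Arguments klip_le {R X m iota K f} x y.

(** * Integrals of bounded measurable functions against a probability *)

Section mean.
Context d (T : measurableType d) (R : realType).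
Implicit Types (nu : probability T R) (f g : T -> R).

Definition bounded_meas f :=
  measurable_fun [set: T] f /\ exists M, forall x, `|f x| <= M.

Lemma integrable_bounded_meas nu f : bounded_meas f ->
  nu.-integrable [set: T] (EFin \o f).
Proof.
move=> [mf [M fM]]; apply: measurable_bounded_integrable => //.
  by rewrite (le_lt_trans (probability_le1 nu measurableT))// ltry.
exists M; split; first exact: num_real.
by move=> N MN x _; rewrite /= (le_trans (fM x))// ltW.
Qed.

Definition mean nu f : R := \int[nu]_(x in [set: T]) f x.

Lemma meanD nu f g : bounded_meas f -> bounded_meas g ->
  mean nu (fun x => f x + g x) = mean nu f + mean nu g.
Proof.
by move=> bf bg; rewrite /mean RintegralD//; exact: integrable_bounded_meas.
Qed.

Lemma meanZ nu a f : bounded_meas f ->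
  mean nu (fun x => a * f x) = a * mean nu f.
Proof.
by move=> bf; rewrite /mean RintegralZl//; exact: integrable_bounded_meas.
Qed.

Lemma mean_cst nu c : mean nu (fun=> c) = c.
Proof. 
by rewrite /mean Rintegral_cst// [X in fine X](probability_setT nu) mulr1. Qed.

Lemma le_mean nu f g : bounded_meas f -> bounded_meas g ->
  (forall x, f x <= g x) -> mean nu f <= mean nu g.
Proof.
by move=> bf bg fg; rewrite /mean le_Rintegral//; exact: integrable_bounded_meas.
Qed.

Lemma EFin_mean nu f : bounded_meas f ->
  (mean nu f)%:E = (\int[nu]_x (f x)%:E)%E.
Proof.
move=> bf; rewrite /mean /Rintegral fineK//.
by apply: integrable_fin_num => //; exact: integrable_bounded_meas.
Qed.

(** Markov's inequality, in a form without division. *)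
Lemma measure_le_mean nu f A a : bounded_meas f -> measurable A ->
  (forall x, 0 <= f x) -> 0 <= a -> (forall x, A x -> a <= f x) ->
  (a%:E * nu A <= (mean nu f)%:E)%E.
Proof.
move=> bf mA f0 a0 Af; rewrite EFin_mean// -integral_cst//.
apply: (@le_trans _ _ (\int[nu]_(x in A) (f x)%:E)%E).
  by apply: ge0_le_integral => //=; exact/measurable_EFinP/measurable_funTS/bf.1.
apply: ge0_subset_integral => //=; first exact/measurable_EFinP/bf.1.
by move=> x _; rewrite lee_fin.
Qed.

Lemma mean_le_measure nu f A : bounded_meas f -> measurable A ->
  (forall x, f x <= \1_A x) -> (forall x, 0 <= f x) ->
  ((mean nu f)%:E <= nu A)%E.
Proof.
move=> bf mA fA f0; rewrite EFin_mean// -[in leRHS](setIT A) -integral_indic//.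
apply: ge0_le_integral => //=.
- by move=> x _; rewrite lee_fin.
- exact/measurable_EFinP/bf.1.
- exact/measurable_EFinP/measurable_indic.
- by move=> x _; rewrite lee_fin.
Qed.

End mean.

(** * Topology and Borel structure of the sphere *)

Section sphere_topology.
Context {R : realType} {n : nat}.
Local Notation S := (sphere R n).
Implicit Types (u x : S) (U : set S).

Lemma sphere_openP U : open U <->
  forall x, U x -> exists2 r, 0 < r & forall y, eucdist (val x) (val y) < r -> U y.
Proof.
split=> [[B oB <-] x Bx|UP].
  have /nbhs_eucdist[r r0 rB] : nbhs (set_val x) B by apply: open_nbhs_nbhs.
  by exists r => // y xyr; exact: rB.
exists (\bigcup_(O in [set O : set 'rV[R]_n.+1 | open O /\ set_val @^-1` O `<=` U]) O).
  by apply: bigcup_open => O [].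
apply/seteqP; split=> [x [V [_ VU] Vx]|x Ux]; first exact: VU.
have [r r0 rU] := UP x Ux.
pose O := [set y : 'rV[R]_n.+1 | eucdist (val x) y < r].
exists O; last by rewrite /O /= eucdistxx.
split; last by move=> y; exact: rU.
rewrite openE => y Oy; apply/nbhs_eucdist; exists (r - eucdist (val x) y).
  by rewrite subr_gt0.
move=> z yz; rewrite /O /= (le_lt_trans (eucdist_triangle y _ _))//.
by rewrite -ltrBrDl.
Qed.

Lemma compact_sphere : compact [set: S].
Proof.
move=> F FF _.
have FK : (val @ F) (unit_sphere R n).
  apply: (@filterS S F _ setT) => [x _|]; [exact: (dot_sphere x)|exact: filterT].
have [p [Kp clp]] := @compact_unit_sphere R n (val @ F) (fmap_proper_filter val FF) FK.
pose q : S := SigSub (mem_set Kp) : set_type (unit_sphere R n).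
exists q; split=> // A B FA [B' [[V oV VB'] B'q B'B]].
have [| |y [Ay Vy]] := clp (val @` A) V.
- by apply: (@filterS S F _ A) => // x Ax; exists x.
- by apply: open_nbhs_nbhs; split => //; move: B'q; rewrite -VB'.
case: Ay => x Ax xy; exists x; split => //; apply: B'B; rewrite -VB' /=.
by rewrite set_valE xy.
Qed.

Lemma open_lip_gt (f : S -> R) a : lip val f ->
  open [set x | a < f x].
Proof.
move=> /lip_klip[K K0 Kf]; apply/sphere_openP => x /= ax.
exists ((f x - a) / K) => [|y]; first by rewrite divr_gt0// subr_gt0.
by rewrite ltr_pdivlMr// => xy; have := klip_le x y Kf; lra.
Qed.

Lemma measurable_lip (f : S -> R) : lip val f -> measurable_fun [set: S] f.
Proof.
move=> lf _; apply: (measurability _ (RGenOInfty.measurableE R)) => //.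
move=> _ [_ [a ->] <-]; rewrite setTI; apply: sub_sigma_algebra.
rewrite (_ : _ @^-1` _ = [set x | a < f x]); first exact: open_lip_gt.
by apply/seteqP; split => x /=; rewrite in_itv/= andbT.
Qed.

Lemma enorm_sphere u : enorm (val u) <= 1.
Proof. by rewrite enorm1// dot_sphere. Qed.

Lemma bounded_meas_lip (f : S -> R) : lip val f -> bounded_meas f.
Proof.
move=> lf; split; first exact: measurable_lip.
by have [M _ fM] := lip_bounded enorm_sphere lf; exists M.
Qed.

End sphere_topology.

Lemma open_measurable_sphere (R : realType) n (U : set (sphere R n)) :
  open U -> measurable U.
Proof. exact: sub_sigma_algebra. Qed.

Lemma mean_gt0 (R : realType) n (nu : probability (sphere R n) R)
    (f : sphere R n -> R) (x : sphere R n) :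
  lip val f -> (forall y, 0 <= f y) -> 0 < f x ->
  (forall U : set (sphere R n), open U -> U x -> (0 < nu U)%E) -> 0 < mean nu f.
Proof.
move=> lf f0 fx nux; rewrite -lte_fin.
have fx2 : 0 < f x / 2 by rewrite divr_gt0.
have oU := open_lip_gt (f x / 2) lf.
have := measure_le_mean nu (bounded_meas_lip lf) (open_measurable_sphere oU)
  f0 (ltW fx2) (fun y => @ltW _ _ _ _).
apply: lt_le_trans; rewrite mule_gt0 ?lte_fin// nux//=.
by rewrite ltr_pdivrMr//; lra.
Qed.

(** * Lazy random walks *)

Lemma exprn_lt_eps (R : realType) (r e : R) : 0 <= r < 1 -> 0 < e ->
  exists j, r ^+ j < e.
Proof.
move=> /andP[r0 r1] e0; have /cvgrPdist_lt/(_ e e0)[N _ Nr] : r ^+ k @[k --> \oo] --> 0.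
  by apply: cvg_expr; rewrite ger0_norm.
exists N; have := Nr N (leqnn N).
by rewrite /= sub0r normrN ger0_norm// exprn_ge0.
Qed.

(** A normalised positive linear functional. [L] takes arbitrary functions, but except on constants
    the axioms constrain it only on Lipschitz ones; this is the common interface of [mean] and of
    the limit functional of a walk. *)
Record positive_functional (R : realType) (X : Type) m (iota : X -> 'rV[R]_m)
    (L : (X -> R) -> R) : Prop := PositiveFunctional {
  functionalD : forall f g, lip iota f -> lip iota g ->
    L (fun x => f x + g x) = L f + L g;
  functionalZ : forall a f, lip iota f -> L (fun x => a * f x) = a * L f;
  functional_cst : forall c, L (fun=> c) = c;
  le_functional : forall f g, lip iota f -> lip iota g ->
    (forall x, f x <= g x) -> L f <= L g }.

Lemma functional_sum (R : realType) (X I : Type) m (iota : X -> 'rV[R]_m)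
    (L : (X -> R) -> R) (r : seq I) (F : I -> X -> R) :
  positive_functional iota L -> (forall i, lip iota (F i)) ->
  L (fun x => \sum_(i <- r) F i x) = \sum_(i <- r) L (F i).
Proof.
move=> [LD _ Lc _] lF; elim: r => [|i r IH].
  by under eq_fun do rewrite big_nil; rewrite Lc big_nil.
under eq_fun do rewrite big_cons; rewrite LD//; last exact: lip_sum.
by rewrite IH big_cons.
Qed.

Lemma positive_mean (R : realType) n (nu : probability (sphere R n) R) :
  positive_functional val (mean nu).
Proof.
split => [f g lf lg|a f lf|c|f g lf lg fg].
- by apply: meanD; exact: bounded_meas_lip.
- by apply: meanZ; exact: bounded_meas_lip.
- exact: mean_cst.
- by apply: le_mean => //; exact: bounded_meas_lip.
Qed.

Section random_walk.
Context {R : realType} {n m : nat} (mu : probability (sphere R n) R).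
Local Notation S := (sphere R n).
Context (G : set S) (X : Type) (iota : X -> 'rV[R]_m) (Phi : S -> X -> X).
Context (B C : R) (x0 : X).
Local Notation D x y := (eucdist (iota x) (iota y)).
Hypothesis suppG : forall u (U : set S), G u -> open U -> U u -> (0 < mu U)%E.
Hypothesis PhiX : forall u x y, D (Phi u x) (Phi u y) <= D x y.
Hypothesis PhiS : forall u v x,
  D (Phi u x) (Phi v x) <= C * eucdist (val u) (val v).
Hypothesis iotaB : forall x, enorm (iota x) <= B.
Hypothesis iota_compact : compact (range iota).
Implicit Types (f g : X -> R) (x y : X) (u : S).

Inductive reach : X -> X -> Prop :=
| reach0 x : reach x x
| reachS u x y : G u -> reach (Phi u x) y -> reach x y.

(* Laziness makes a point reachable in j steps reachable in any larger number of
   steps, with positive probability. *)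
Definition walk f x : R := (f x + mean mu (fun u => f (Phi u x))) / 2.

Lemma orbit_lip f x : lip iota f -> lip val (fun u => f (Phi u x)).
Proof.
move=> /lip_klip[K K0 Kf]; exists (K * C) => u v.
by rewrite (le_trans (Kf _ _))// -mulrA ler_wpM2l// ltW.
Qed.

Let orbit_bounded f x : lip iota f -> bounded_meas (fun u => f (Phi u x)).
Proof. by move=> lf; exact/bounded_meas_lip/orbit_lip. Qed.

(** Because the steps are 1-Lipschitz, [K] does not grow: all iterates share one modulus of
    continuity. *)
Lemma klip_walk K f : 0 <= K -> klip iota K f -> klip iota K (walk f).
Proof.
move=> K0 Kf; have lf : lip iota f by exists K.
apply: klipP => x y; rewrite /walk.
have : mean mu (fun u => f (Phi u x)) <=
    mean mu (fun u => f (Phi u y) + K * D x y).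
  apply: le_mean; first exact: orbit_bounded.
    by apply/bounded_meas_lip/lipD; [exact: orbit_lip|exact: lip_cst].
  move=> u; rewrite (le_trans (klip_le (Phi u x) (Phi u y) Kf))// lerD2l.
  by rewrite ler_wpM2l.
rewrite meanD; [|exact: orbit_bounded|exact/bounded_meas_lip/lip_cst].
rewrite mean_cst; have := klip_le x y Kf; lra.
Qed.

Lemma lip_walk f : lip iota f -> lip iota (walk f).
Proof. by move=> /lip_klip[K /ltW K0 Kf]; exists K; exact: klip_walk. Qed.

Lemma walkD f g : lip iota f -> lip iota g ->
  walk (fun x => f x + g x) = fun x => walk f x + walk g x.
Proof.
move=> lf lg; apply/funext => x; rewrite /walk meanD; try exact: orbit_bounded.
lra.
Qed.

Lemma walkZ a f : lip iota f -> walk (fun x => a * f x) = fun x => a * walk f x.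
Proof.
move=> lf; apply/funext => x; rewrite /walk meanZ; last exact: orbit_bounded.
lra.
Qed.

Lemma walk_cst c : walk (fun=> c) = fun=> c.
Proof. by apply/funext => x; rewrite /walk mean_cst; lra. Qed.

Lemma le_walk f g : lip iota f -> lip iota g -> (forall x, f x <= g x) ->
  forall x, walk f x <= walk g x.
Proof.
move=> lf lg fg x; rewrite /walk ler_pM2r// lerD//.
by apply: le_mean => [||u]; [exact: orbit_bounded|exact: orbit_bounded|].
Qed.

Lemma klip_iter_walk k K f : 0 <= K -> klip iota K f ->
  klip iota K (iter k walk f).
Proof. by move=> K0 Kf; elim: k => //= k; exact: klip_walk. Qed.

Lemma lip_iter_walk k f : lip iota f -> lip iota (iter k walk f).
Proof. by move=> lf; elim: k => //= k; exact: lip_walk. Qed.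

Lemma iter_walkD k f g : lip iota f -> lip iota g ->
  iter k walk (fun x => f x + g x) = fun x => iter k walk f x + iter k walk g x.
Proof.
by move=> lf lg; elim: k => //= k ->; rewrite walkD//; exact: lip_iter_walk.
Qed.

Lemma iter_walkZ k a f : lip iota f ->
  iter k walk (fun x => a * f x) = fun x => a * iter k walk f x.
Proof. by move=> lf; elim: k => //= k ->; rewrite walkZ//; exact: lip_iter_walk. Qed.

Lemma iter_walk_cst k c : iter k walk (fun=> c) = fun=> c.
Proof. by elim: k => //= k ->; exact: walk_cst. Qed.

Lemma le_iter_walk k f g : lip iota f -> lip iota g ->
  (forall x, f x <= g x) -> forall x, iter k walk f x <= iter k walk g x.
Proof.
by move=> lf lg fg; elim: k => //= k IH; apply: le_walk => //; exact: lip_iter_walk.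
Qed.

Lemma iter_walk_ge k f c : lip iota f -> (forall x, c <= f x) ->
  forall x, c <= iter k walk f x.
Proof.
move=> lf cf x; have := le_iter_walk k (lip_cst _ c) lf cf x.
by rewrite iter_walk_cst.
Qed.

Lemma iter_walk_le k f c : lip iota f -> (forall x, f x <= c) ->
  forall x, iter k walk f x <= c.
Proof.
move=> lf cf x; have := le_iter_walk k lf (lip_cst _ c) cf x.
by rewrite iter_walk_cst.
Qed.

Lemma walk_half f x : lip iota f -> (forall y, 0 <= f y) -> f x / 2 <= walk f x.
Proof.
move=> lf f0; rewrite /walk ler_pM2r// lerDl -(mean_cst mu 0).
by apply: le_mean => //; [exact/bounded_meas_lip/lip_cst|exact: orbit_bounded].
Qed.

Lemma walk_gt0 f x u : lip iota f -> (forall y, 0 <= f y) -> G u ->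
  0 < f (Phi u x) -> 0 < walk f x.
Proof.
move=> lf f0 Gu fu; rewrite divr_gt0// ltr_wpDl//.
apply: (@mean_gt0 _ _ _ _ u) => //; first exact: orbit_lip.
by move=> U oU Uu; exact: suppG Gu oU Uu.
Qed.

Lemma reach_walk_gt0 f x y : lip iota f -> (forall z, 0 <= f z) ->
  reach x y -> 0 < f y -> exists k, 0 < iter k walk f x.
Proof.
move=> lf f0; elim => [{}x|u {}x {}y Gu _ IH] fy; first by exists 0%N.
have [k fk] := IH fy; exists k.+1; rewrite iterS; apply: walk_gt0 Gu fk.
  exact: lip_iter_walk.
exact: iter_walk_ge.
Qed.

(** Laziness loses at most a factor 1/2 per step, while the threshold [q ^+ k] drops by a factor
    1/4. Hence the sets where the [k]-th iterate exceeds [q ^+ k] increase, and every point at which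
    some iterate is positive enters one of them; compactness then yields a single [k]. *)
Lemma walk_minorization f : lip iota f -> (forall x, 0 <= f x) ->
  (forall x, exists2 y, reach x y & 0 < f y) ->
  exists k c, 0 < c /\ forall x, c <= iter k walk f x.
Proof.
move=> /[dup] lf /lip_klip[K K0 Kf] f0 facc.
have lk k := lip_iter_walk k lf; have f0k k := iter_walk_ge k lf f0.
pose q : R := 4^-1; have q0 : 0 < q by rewrite invr_gt0.
pose U k v := exists2 x, iota x = v & q ^+ k < iter k walk f x.
have [| | |_ [x _ <-]|k Uk] := @compact_increasing_cover R m (range iota) U.
- exact: iota_compact.
- move=> k _ _ [x <- Ukx]; exists x => //; rewrite iterS.
  apply: lt_le_trans (walk_half x (lk k) (f0k k)).
  have := exprn_gt0 k q0; rewrite exprSr /q; lra.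
- move=> k _ _ [x <- Ukx]; exists ((iter k walk f x - q ^+ k) / K).
    by rewrite divr_gt0// subr_gt0.
  move=> _ [y _ <-]; rewrite ltr_pdivlMr// => xy; exists y => //.
  by have := klip_le x y (klip_iter_walk k (ltW K0) Kf); lra.
- have [y xy fy] := facc x; have [k fk] := reach_walk_gt0 lf f0 xy fy.
  set a := iter k walk f x in fk.
  have half j : a / 2 ^+ j <= iter (j + k) walk f x.
    elim: j => [|j IH]; first by rewrite expr0 divr1.
    rewrite addSn iterS; apply: le_trans (walk_half x (lk _) (f0k _)).
    by rewrite exprSr invfM mulrA ler_pM2r.
  have [j aj] : exists j, q ^+ k * 2^-1 ^+ j < a.
    have half1 : 0 <= (2^-1 : R) < 1 by rewrite invr_ge0 ler0n invf_lt1 ?ltr1n.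
    have [j jak] := exprn_lt_eps half1 (divr_gt0 fk (exprn_gt0 k q0)).
    by exists j; rewrite mulrC -ltr_pdivlMr// exprn_gt0.
  exists (j + k)%N, x => //; apply: lt_le_trans (half j).
  rewrite ltr_pdivlMr ?exprn_gt0//; apply: le_lt_trans aj.
  rewrite exprD mulrAC mulrC ler_pM2l ?exprn_gt0// -exprMn.
  by rewrite le_eqVlt (_ : q * 2 = 2^-1) ?eqxx// /q; lra.
exists k, (q ^+ k); split; first exact: exprn_gt0.
move=> x; have [y yx /ltW Uy] := Uk _ (ex_intro2 _ _ x I erefl).
have := klip_le y x (klip_iter_walk k (ltW K0) Kf).
by rewrite yx eucdistxx mulr0 addr0; exact: le_trans.
Qed.

(** Open sets are encoded as positivity sets of nonnegative Lipschitz functions, the form in which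
    [walk_minorization] consumes reachability. *)
Definition irreducible := forall f z, lip iota f -> (forall x, 0 <= f x) ->
  0 < f z -> forall x, exists2 y, reach x y & 0 < f y.

Hypothesis irr : irreducible.

(** * Doeblin contraction of the oscillation *)

Section oscillation.
Context (f : X -> R) (K eta c : R) (k : nat).
Hypotheses (K0 : 0 < K) (Kf : klip iota K f) (eta0 : 0 < eta).
(** A bump of height 1 at [x0], supported so close to [x0] that a [K]-Lipschitz function varies
    there by at most [eta]. It depends on [f] only through [K], so it also serves all iterates of
    [f]. *)
Let phi y := Num.max 0 (1 + - (K / eta) * D y x0).
Hypotheses (c0 : 0 < c) (cphi : forall x, c <= iter k walk phi x).

Let phi_lip : lip iota phi.
Proof.
by apply/lip_max/lipD/lipZ/(ex_intro _ 1)/klip_dist; exact: lip_cst.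
Qed.

Let phi_le1 y : phi y <= 1.
Proof.
have : 0 <= K / eta * D y x0 by rewrite mulr_ge0 ?eucdist_ge0// divr_ge0 ?ltW.
by rewrite /phi mulNr; have [?|?] := leP 0 (1 - K / eta * D y x0); lra.
Qed.

Lemma bump_minorant_le1 : c <= 1.
Proof. exact: le_trans (cphi x0) (iter_walk_le k phi_lip phi_le1 x0). Qed.

Lemma bump_near y : 0 < phi y -> K * D y x0 < eta.
Proof.
rewrite /phi lt_max ltxx/= mulNr subr_gt0 mulrAC.
by rewrite ltr_pdivrMr// mul1r.
Qed.

(** Near [x0] the function [g] is at least [a + s] and at most [a + w - t], so it lies between
    [a + s * phi] and [a + w - t * phi]. After [k] steps [phi] is at least [c] everywhere, and the
    width drops by [c * (s + t)], where [s + t >= w - 2 * eta]. *)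
Lemma walk_shrink g a w : klip iota K g -> (forall x, a <= g x <= a + w) ->
  exists a', forall x,
    a' <= iter k walk g x <= a' + (2 * eta + (1 - c) * (w - 2 * eta)).
Proof.
move=> Kg gaw; have lg : lip iota g by exists K.
have phi0 y : 0 <= phi y by rewrite le_max lexx.
pose s := Num.max 0 (g x0 - eta - a); pose t := Num.max 0 (a + w - g x0 - eta).
have sE : g x0 - eta - a <= s by rewrite le_max lexx orbT.
have tE : a + w - g x0 - eta <= t by rewrite le_max lexx orbT.
have s0 : 0 <= s by rewrite le_max lexx.
have t0 : 0 <= t by rewrite le_max lexx.
have lower y : a + s * phi y <= g y.
  have /andP[ag _] := gaw y.
  have [y0|y0] := leP (phi y) 0.
    by have := phi0 y; nra.
  have := bump_near y0; have := klip_le x0 y Kg; rewrite eucdistC => h1 h2.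
  have : s * phi y <= s by rewrite ler_piMr.
  by rewrite /s; have [?|?] := leP 0 (g x0 - eta - a); lra.
have upper y : g y <= a + w + (- t) * phi y.
  have /andP[_ gb] := gaw y.
  have [y0|y0] := leP (phi y) 0.
    by have := phi0 y; nra.
  have := bump_near y0; have := klip_le y x0 Kg => h1 h2.
  have : t * phi y <= t by rewrite ler_piMr.
  by rewrite /t; have [?|?] := leP 0 (a + w - g x0 - eta); lra.
have lp r : lip iota (fun x => r * phi x) by exact: lipZ.
exists (a + s * c) => x.
have := le_iter_walk k (lipD (lip_cst iota a) (lp s)) lg lower x.
have := le_iter_walk k lg (lipD (lip_cst iota (a + w)) (lp (- t))) upper x.
rewrite !iter_walkD ?iter_walkZ ?iter_walk_cst//; try exact: lip_cst.
have := cphi x; set p := iter k walk phi x; set h := iter k walk g x => cp hu hl.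
have sc : s * c <= s * p by rewrite ler_wpM2l.
have tc : t * c <= t * p by rewrite ler_wpM2l.
have : c * (w - 2 * eta) <= c * (s + t) by rewrite ler_pM2l//; lra.
by move=> ?; apply/andP; split; lra.
Qed.

Lemma walk_osc_iter a w : (forall x, a <= f x <= a + w) ->
  forall j, exists a', forall x,
    a' <= iter (j * k) walk f x <= a' + (2 * eta + (1 - c) ^+ j * (w - 2 * eta)).
Proof.
move=> faw; elim=> [|j [a' IH]].
  exists a => x; rewrite mul0n expr0 mul1r.
  by have -> : 2 * eta + (w - 2 * eta) = w by ring.
have Kj := klip_iter_walk (j * k) (ltW K0) Kf.
have [a'' Ha] := walk_shrink Kj IH; exists a'' => x.
by rewrite mulSn iterD exprS -mulrA; move: (Ha x); rewrite addrAC subrr add0r.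
Qed.

End oscillation.

Lemma walk_osc f e : lip iota f -> 0 < e ->
  exists k a, forall x, a <= iter k walk f x <= a + e.
Proof.
move=> /[dup] lf /lip_klip[K K0 Kf] e0; have [M M0 fM] := lip_bounded iotaB lf.
(* Half of [e] pays for the floor [2 * eta] that the contraction cannot go below, the other half for
   the geometric term. *)
pose eta := e / 4; have eta0 : 0 < eta by rewrite divr_gt0.
pose phi y := Num.max 0 (1 + - (K / eta) * D y x0).
have phi_lip : lip iota phi.
  by apply/lip_max/lipD/lipZ/(ex_intro _ 1)/klip_dist; exact: lip_cst.
have phi0 y : 0 <= phi y by rewrite le_max lexx.
have phix0 : 0 < phi x0 by rewrite lt_max eucdistxx mulr0 addr0 ltr01 orbT.
have [k [c [c0 cphi]]] := walk_minorization phi_lip phi0 (irr phi_lip phi0 phix0).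
have c1 := bump_minorant_le1 K0 eta0 cphi.
have faw x : - M <= f x <= - M + 2 * M.
  by have := fM x; rewrite ler_norml => /andP[? ?]; apply/andP; split; lra.
have [||j jM] := @exprn_lt_eps R (1 - c) (2 * eta / (2 * M)).
- by apply/andP; split; lra.
- by rewrite divr_gt0 ?mulr_gt0.
have [a Ha] := walk_osc_iter K0 Kf eta0 c0 cphi faw j.
exists (j * k)%N, a => x; have /andP[-> /=] := Ha x; move/le_trans; apply.
rewrite lerD2l; move: jM; rewrite ltr_pdivlMr ?mulr_gt0// => jM.
have p0 : 0 <= (1 - c) ^+ j by rewrite exprn_ge0//; lra.
have e4 : e = 4 * eta by rewrite /eta; lra.
have := mulr_ge0 p0 (ltW eta0); move: jM; rewrite [X in _ -> _ -> _ <= X]e4.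
set p := _ ^+ j; lra.
Qed.

(** The infimum of the [k]-th iterate is nondecreasing in [k], so this is the limit of the infima.
    Being expressed by bounds over the whole of [X], it is visibly unchanged by bijections of [X]
    that commute with the walk. *)
Definition ergodic_mean f : R :=
  sup [set a | exists k, forall x, a <= iter k walk f x].

Lemma iter_walk_mono k j f a : lip iota f -> (k <= j)%N ->
  (forall x, a <= iter k walk f x) -> forall x, a <= iter j walk f x.
Proof.
by move=> lf /subnK <- ak; rewrite iterD; apply: iter_walk_ge => //; exact: lip_iter_walk.
Qed.

Lemma walk_cvg f e : lip iota f -> 0 < e ->
  exists N, forall k, (N <= k)%N -> forall x,
    `|iter k walk f x - ergodic_mean f| <= e.
Proof.
move=> lf e0; have [N [a Ha]] := walk_osc lf e0.
have aN x : a <= iter N walk f x by have /andP[] := Ha x.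
have Na x : iter N walk f x <= a + e by have /andP[] := Ha x.
have ub b : (exists k, forall x, b <= iter k walk f x) -> b <= a + e.
  move=> [k bk]; have := iter_walk_mono lf (leq_maxl k N) bk x0.
  move/le_trans; apply.
  rewrite -(subnK (leq_maxr k N)) iterD; apply: iter_walk_le => //.
  exact: lip_iter_walk.
have hs : has_sup [set a | exists k, forall x, a <= iter k walk f x].
  by split; [exists a, N|exists (a + e) => b /ub].
have a_le : a <= ergodic_mean f by apply: ub_le_sup; [exact: hs.2|exists N].
have le_a : ergodic_mean f <= a + e by apply: ge_sup; [exact: hs.1|move=> b /ub].
exists N => k Nk x; have ak := iter_walk_mono lf Nk aN x.
have ka : iter k walk f x <= a + e.
  rewrite -(subnK Nk) iterD; apply: iter_walk_le => //; exact: lip_iter_walk.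
by rewrite ler_norml; apply/andP; split; lra.
Qed.

(** Convergence of the iterates is uniform, so testing one point for each large [k] identifies the
    limit. *)
Lemma ergodic_mean_eq f l : lip iota f ->
  (forall e, 0 < e -> exists N, forall k, (N <= k)%N ->
    exists x, `|iter k walk f x - l| <= e) -> ergodic_mean f = l.
Proof.
move=> lf fl; apply/eqP; rewrite -subr_eq0 -normr_le0.
apply/ler_addgt0Pr => e e0; rewrite add0r.
have e2 : 0 < e / 2 by rewrite divr_gt0.
have [N HN] := walk_cvg lf e2; have [N' HN'] := fl _ e2.
have [x Hx] := HN' _ (leq_maxr N N').
have := HN _ (leq_maxl N N') x; move: Hx; set z := iter _ _ _ _.
by rewrite !ler_norml => /andP[? ?] /andP[? ?]; apply/andP; split; lra.
Qed.

Lemma ergodic_meanD f g : lip iota f -> lip iota g ->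
  ergodic_mean (fun x => f x + g x) = ergodic_mean f + ergodic_mean g.
Proof.
move=> lf lg; apply: ergodic_mean_eq => [|e e0]; first exact: lipD.
have e2 : 0 < e / 2 by rewrite divr_gt0.
have [N HN] := walk_cvg lf e2; have [N' HN'] := walk_cvg lg e2.
exists (maxn N N') => k; rewrite geq_max => /andP[Nk N'k]; exists x0.
rewrite iter_walkD//; have := HN _ Nk x0; have := HN' _ N'k x0.
by rewrite !ler_norml => /andP[? ?] /andP[? ?]; apply/andP; split; lra.
Qed.

Lemma ergodic_mean_cst c : ergodic_mean (fun=> c) = c.
Proof.
apply: ergodic_mean_eq => [|e e0]; first exact: lip_cst.
by exists 0%N => k _; exists x0; rewrite iter_walk_cst subrr normr0 ltW.
Qed.

Lemma ergodic_meanZ a f : lip iota f ->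
  ergodic_mean (fun x => a * f x) = a * ergodic_mean f.
Proof.
move=> lf; apply: ergodic_mean_eq => [|e e0]; first exact: lipZ.
have a0 : 0 < `|a| + 1 by rewrite ltr_wpDl.
have [N HN] := walk_cvg lf (divr_gt0 e0 a0).
exists N => k Nk; exists x0; rewrite iter_walkZ// -mulrBr normrM.
have := HN k Nk x0; rewrite ler_pdivlMr// mulrDr mulr1 mulrC; apply: le_trans.
by rewrite lerDl.
Qed.

Lemma ergodic_mean_ge k f c : lip iota f -> (forall x, c <= iter k walk f x) ->
  c <= ergodic_mean f.
Proof.
move=> lf ck; apply/ler_addgt0Pr => e e0; have [N HN] := walk_cvg lf e0.
have := HN _ (leq_maxr k N) x0; have := iter_walk_mono lf (leq_maxl k N) ck x0.
by rewrite ler_norml => ? /andP[? ?]; lra.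
Qed.

Lemma le_ergodic_mean f g : lip iota f -> lip iota g ->
  (forall x, f x <= g x) -> ergodic_mean f <= ergodic_mean g.
Proof.
move=> lf lg fg; rewrite -subr_ge0 -mulN1r -ergodic_meanZ// -ergodic_meanD//.
  apply: (@ergodic_mean_ge 0) => [|x]; last by rewrite /= mulN1r subr_ge0.
  by apply: lipD => //; exact: lipZ.
exact: lipZ.
Qed.

Lemma ergodic_mean_walk f : lip iota f -> ergodic_mean (walk f) = ergodic_mean f.
Proof.
move=> lf; apply: ergodic_mean_eq => [|e e0]; first exact: lip_walk.
have [N HN] := walk_cvg lf e0; exists N => k Nk; exists x0.
by rewrite -iterSr HN// (leq_trans Nk).
Qed.

Lemma ergodic_mean_gt0 f z : lip iota f -> (forall x, 0 <= f x) -> 0 < f z ->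
  0 < ergodic_mean f.
Proof.
move=> lf f0 fz.
have [k [c [c0 ck]]] := walk_minorization lf f0 (irr lf f0 fz).
exact: lt_le_trans c0 (ergodic_mean_ge lf ck).
Qed.

Lemma positive_ergodic_mean : positive_functional iota ergodic_mean.
Proof.
split; [exact: ergodic_meanD|exact: ergodic_meanZ|exact: ergodic_mean_cst|
  exact: le_ergodic_mean].
Qed.

End random_walk.

(** * The orthogonal group *)

Section matrix_norm.
Context {R : realType}.

Lemma enorm_mulmx m p (x : 'rV[R]_m) (A : 'M[R]_(m, p)) :
  enorm (x *m A) <= enorm x * enorm (mxvec A).
Proof.
rewrite /enorm -sqrtrM ?dot_ge0// ler_wsqrtr// dot_mxvec.
(* The trace becomes that of [A^T *m A], a sum of squared column norms; Cauchy-Schwarz then applies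
   column by column. *)
rewrite -[X in _ * \tr X]trmxK trmx_mul trmxK mxtrace_tr mxtrace_mulC.
rewrite dotE /mxtrace mulr_sumr; apply: ler_sum => j _.
have -> : (x *m A) 0 j = dot x (col j A)^T.
  by rewrite dotE mxE; apply: eq_bigr => i _; rewrite !mxE.
have -> : (A^T *m A) j j = dot (col j A)^T (col j A)^T.
  by rewrite dotE mxE; apply: eq_bigr => i _; rewrite !mxE.
by rewrite -expr2 CauchySchwarz.
Qed.

Lemma enorm_outer m p (x : 'rV[R]_m) (y : 'rV[R]_p) :
  enorm (mxvec (x^T *m y)) = enorm x * enorm y.
Proof.
rewrite /enorm -sqrtrM ?dot_ge0// dot_mxvec trmx_mul trmxK mulmxA mxtrace_mulC.
rewrite -mulmxA [y *m y^T]mx11_scalar mul_mx_scalar.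
by rewrite -scalemxAr mxtraceZ trace_mx11 mulrC.
Qed.

Lemma refl_mxE m (u : 'rV[R]_m) : refl_mx u = 1%:M - 2 *: (u^T *m u).
Proof.
apply/row_matrixP => i; rewrite !rowE mul_refl_mx mulmxBr mulmx1 /refl.
rewrite -scalemxAr mulmxA [_ *m u^T]mx11_scalar mul_scalar_mx.
by rewrite scalerA.
Qed.

Lemma trmx_refl_mx m (u : 'rV[R]_m) : (refl_mx u)^T = refl_mx u.
Proof. by rewrite refl_mxE linearB/= trmx1 linearZ/= trmx_mul trmxK. Qed.

Lemma reflK m (u x : 'rV[R]_m) : dot u u = 1 -> refl u (refl u x) = x.
Proof.
move=> u1; rewrite /refl; apply/rowP => i; rewrite !mxE !dot_lin u1; ring.
Qed.

Lemma refl_mxK m (u : 'rV[R]_m) : dot u u = 1 -> refl_mx u *m refl_mx u = 1%:M.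
Proof.
by move=> /refl_mx_orthogonal; rewrite /orthogonal_mx /= trmx_refl_mx.
Qed.

Lemma refl_mx_dist m (u v : 'rV[R]_m) : dot u u = 1 -> dot v v = 1 ->
  enorm (mxvec (refl_mx u - refl_mx v)) <= 4 * eucdist u v.
Proof.
move=> u1 v1; have -> : refl_mx u - refl_mx v =
    (- 2) *: (u^T *m (u - v) + (u - v)^T *m v).
  have -> : (u - v)^T = u^T - v^T by rewrite linearB.
  rewrite !refl_mxE mulmxBr mulmxBl addrA subrK.
  move: (u^T *m u) (v^T *m v) => A B.
  by apply/matrixP => i j; rewrite !mxE; ring.
rewrite linearZ/= enormZ normrN normr_nat linearD/=.
have -> : 4 = 2 * 2 :> R by ring.
rewrite -mulrA ler_pM2l// (le_trans (enormD _ _))// !enorm_outer.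
by rewrite (enorm1 u1) (enorm1 v1) mul1r mulr1 /eucdist; lra.
Qed.

End matrix_norm.

(** * O(d) as a compact metric group acting on the sphere *)

Section orthogonal_group.
Context {R : realType} {n : nat}.
Local Notation S := (sphere R n).
Local Notation O := (set_type (@orthogonal_mx R n.+1)).
Implicit Types (u x y : S) (g h : O).

Lemma orthogonal_mul (A B : 'M[R]_n.+1) : orthogonal_mx A -> orthogonal_mx B ->
  orthogonal_mx (A *m B).
Proof.
rewrite /orthogonal_mx /= => AA BB.
by rewrite trmx_mul mulmxA -(mulmxA A) BB mulmx1.
Qed.

Lemma orthogonal_tr (A : 'M[R]_n.+1) : orthogonal_mx A -> orthogonal_mx A^T.
Proof. by rewrite /orthogonal_mx /= trmxK => /mulmx1C. Qed.

Lemma orthogonal_inv (A : 'M[R]_n.+1) : orthogonal_mx A -> invmx A = A^T.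
Proof.
move=> AA; have [uA _] := mulmx1_unit AA.
by apply: (can_inj (mulKmx uA)); rewrite mulmxV// AA.
Qed.

Lemma val_orthogonal g : orthogonal_mx (val g).
Proof. exact: set_mem (valP g). Qed.

Lemma orthogonal_dot (A : 'M[R]_n.+1) (x y : 'rV[R]_n.+1) : orthogonal_mx A ->
  dot (x *m A) (y *m A) = dot x y.
Proof.
by move=> AA; rewrite /dot trmx_mul mulmxA -(mulmxA x) AA mulmx1.
Qed.

Definition orth (A : 'M[R]_n.+1) (AA : orthogonal_mx A) : O := SigSub (mem_set AA).

Definition omul g h : O := orth (orthogonal_mul (val_orthogonal g) (val_orthogonal h)).

Definition orefl u : O := orth (refl_mx_orthogonal (dot_sphere u)).

Lemma act_proof x (A : 'M[R]_n.+1) : orthogonal_mx A ->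
  val x *m A \in unit_sphere R n.
Proof.
by move=> AA; apply/mem_set; rewrite /unit_sphere /= orthogonal_dot// dot_sphere.
Qed.

Definition act x g : S :=
  (SigSub (act_proof x (val_orthogonal g)) : set_type (unit_sphere R n)).

Lemma sphere_transitive x y : exists g, act x g = y.
Proof.
have [<-|xy] := eqVneq x y.
  have o1 : orthogonal_mx (1%:M : 'M[R]_n.+1).
    by rewrite /orthogonal_mx /= trmx1 mulmx1.
  by exists (orth o1); apply: val_inj; rewrite /= mulmx1.
(* The reflection in the normalised difference of two distinct unit vectors exchanges them. *)
pose c := enorm (val x - val y); pose w := c^-1 *: (val x - val y).
have c0 : c != 0.
  apply/eqP => /enorm_eq0/eqP; rewrite subr_eq0 => /eqP/val_inj/eqP.
  by rewrite (negbTE xy).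
have w1 : dot w w = 1.
  by rewrite dotZl dotZr -sqr_enorm -/c; field.
have c2 : c ^+ 2 = 2 * dot (val x) (val x - val y).
  rewrite sqr_enorm !dot_lin !dot_sphere (dotC (val y)); ring.
exists (orth (refl_mx_orthogonal w1)); apply: val_inj.
rewrite /= mul_refl_mx /refl /w dotZr scalerA.
have -> : 2 * (c^-1 * dot (val x) (val x - val y)) * c^-1 = 1.
  by rewrite mulrCA -c2; field.
by rewrite scale1r opprB addrC subrK.
Qed.

Local Notation oiota := (fun g : O => mxvec (val g)).

Lemma omul_dist_l g h k :
  eucdist (oiota (omul k g)) (oiota (omul k h)) = eucdist (oiota g) (oiota h).
Proof.
rewrite /eucdist (_ : _ - _ = mxvec (val k *m (val g - val h))); last first.
  by rewrite mulmxBr linearB.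
rewrite -(linearB mxvec) /enorm !dot_mxvec trmx_mul.
rewrite mulmxA mxtrace_mulC !mulmxA.
by rewrite (mulmx1C (val_orthogonal k)) mul1mx.
Qed.

Lemma omul_dist_r g (A B : O) :
  eucdist (oiota (omul A g)) (oiota (omul B g)) = eucdist (oiota A) (oiota B).
Proof.
rewrite /eucdist (_ : _ - _ = mxvec ((val A - val B) *m val g)); last first.
  by rewrite mulmxBl linearB.
rewrite -(linearB mxvec) /enorm !dot_mxvec trmx_mul.
by rewrite mulmxA -(mulmxA _ (val g)) (val_orthogonal g) mulmx1.
Qed.

Lemma enorm_orthogonal g : enorm (oiota g) <= Num.sqrt n.+1%:R.
Proof. by rewrite /enorm dot_mxvec (val_orthogonal g) mxtrace1. Qed.

Lemma compact_oiota : compact (range oiota).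
Proof.
rewrite (_ : range _ = [set mxvec A | A in @orthogonal_mx R n.+1]).
  exact: compact_orthogonal_mx.
apply/seteqP; split=> [_ [g _ <-]|_ [A AA <-]].
  by exists (val g) => //; exact: val_orthogonal.
by exists (orth AA).
Qed.

Lemma act_dist x g h :
  eucdist (val (act x g)) (val (act x h)) <= eucdist (oiota g) (oiota h).
Proof.
rewrite /eucdist /= -mulmxBr (le_trans (enorm_mulmx _ _))//.
by rewrite (enorm1 (dot_sphere x)) mul1r linearB.
Qed.

End orthogonal_group.

(** * Invariant mean and rigidity *)

Lemma dot_delta (R : realType) m (x : 'rV[R]_m) i : dot x (delta_mx 0 i) = x 0 i.
Proof.
rewrite dotE (bigD1 i)//= mxE !eqxx mulr1 big1 ?addr0// => j ji.
by rewrite mxE (negbTE ji) andbF mulr0.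
Qed.

Section invariant_mean.
Context {R : realType} {n : nat} (mu : probability (sphere R n) R).
Local Notation S := (sphere R n).
Local Notation O := (set_type (@orthogonal_mx R n.+1)).
Local Notation oiota := (fun g : O => mxvec (val g)).
Context (G : set S).
Hypothesis suppG : forall u (U : set S), G u -> open U -> U u -> (0 < mu U)%E.
Hypothesis denseG : @orthogonal_mx R n.+1 `<=`
  closure (generated_subgroup [set refl_mx (val u) | u in G]).
Implicit Types (u x y : S) (g h : O).

(** Multiplying on the left makes the walk commute with right translations, and these induce the
    right action [act] on the sphere: this is the source of the invariance of the mean. *)
Let Phi u g := omul (orefl u) g.

(** Density as an induction principle: a property stable under the group operations is found
    arbitrarily close to any orthogonal matrix. The error [e] is later absorbed by a Lipschitz
    constant. *)
Lemma generated_subgroup_ind (H : set 'M[R]_n.+1) :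
  (forall u, G u -> H (refl_mx (val u))) -> H 1%:M ->
  (forall A B, orthogonal_mx A -> orthogonal_mx B -> H A -> H B -> H (A *m B)) ->
  (forall A, orthogonal_mx A -> H A -> H A^T) ->
  forall A, orthogonal_mx A -> forall e, 0 < e ->
  exists B, [/\ orthogonal_mx B, H B & eucdist (mxvec A) (mxvec B) < e].
Proof.
move=> HG H1 HM HT A oA e e0.
have sub : generated_subgroup [set refl_mx (val u) | u in G] `<=`
    [set B | orthogonal_mx B /\ H B].
  move=> B; apply; split; last first.
    by move=> _ [u Gu <-]; split; [exact/refl_mx_orthogonal/dot_sphere|exact: HG].
  split => [C []//||C C' [oC HC] [oC' HC']|C [oC HC]].
  - by split => //; rewrite /orthogonal_mx /= trmx1 mulmx1.
  - by split; [exact: orthogonal_mul|exact: HM].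
  - by rewrite orthogonal_inv//; split; [exact: orthogonal_tr|exact: HT].
have nA : nbhs A [set B | eucdist (mxvec A) (mxvec B) < e].
  apply/nbhs_ballP; exists (e / (n.+1 * n.+1).+1%:R) => /=.
    by rewrite divr_gt0.
  move=> B [_ AB].
  have := @eucdist_lt_coord R _ (mxvec A) (mxvec B) (e / (n.+1 * n.+1).+1%:R).
  have -> : (n.+1 * n.+1).+1%:R * (e / (n.+1 * n.+1).+1%:R) = e.
    by rewrite mulrC divfK.
  apply; first by rewrite divr_gt0.
  by move=> k; case/mxvec_indexP: k => i j; rewrite !mxvecE; exact: AB.
have [B [/sub[oB HB] AB]] := denseG oA nA.
by exists B.
Qed.

Lemma reach_trans g h k : reach G Phi g h -> reach G Phi h k -> reach G Phi g k.
Proof. by elim => // u x y Gu _ IH /IH; exact: reachS. Qed.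

(** Reflections are involutions, so each step can be undone. Folds admit no such argument. *)
Lemma reach_sym g h : reach G Phi g h -> reach G Phi h g.
Proof.
elim=> [x|u x y Gu _ IH]; first exact: reach0.
apply: reach_trans IH _; apply: (reachS Gu).
have -> : Phi u (Phi u x) = x.
  by apply: val_inj; rewrite /= mulmxA refl_mxK ?dot_sphere// mul1mx.
exact: reach0.
Qed.

Lemma orefl_walk_irreducible : irreducible G oiota Phi.
Proof.
move=> f z /lip_klip[K K0 Kf] f0 fz g.
(* [H] holds the matrices whose left multiplication is realised by steps of the walk. A member close
   to [val z *m (val g)^T] carries [g] within [f z / K] of [z], where [f] is still positive. *)
pose H := [set A : 'M[R]_n.+1 | forall h k, val k = A *m val h -> reach G Phi h k].
have [||||||B [oB HB zB]] := @generated_subgroup_ind H _ _ _ _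
    (val z *m (val g)^T) _ (f z / K) _.
- move=> u Gu h k E; apply: (reachS Gu).
  by have -> : Phi u h = k by [apply: val_inj; rewrite E]; exact: reach0.
- by move=> h k; rewrite mul1mx => /val_inj ->; exact: reach0.
- move=> A B oA oB HA HB h k E; pose l := omul (orth oB) h.
  apply: (@reach_trans h l); first exact: HB.
  by apply: HA; rewrite E /= mulmxA.
- move=> A oA HA h k E; apply: reach_sym; apply: HA.
  by rewrite E mulmxA (oA : A *m A^T = 1%:M) mul1mx.
- by apply: orthogonal_mul; [|apply: orthogonal_tr]; exact: val_orthogonal.
- by rewrite divr_gt0.
exists (omul (orth oB) g); first exact: HB.
have := Kf z (omul (orth oB) g).
pose zg := omul (orth (orthogonal_mul (val_orthogonal z)
  (orthogonal_tr (val_orthogonal g)))) g.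
have -> : oiota z = oiota zg.
  by rewrite /= -mulmxA (mulmx1C (val_orthogonal g)) mulmx1.
rewrite omul_dist_r /= => zB'; move: zB; rewrite ltr_pdivlMr// mulrC => zB.
by have := le_lt_trans zB' zB; rewrite ltr_norml => /andP[_]; lra.
Qed.

Let omulKr g h : exists h', omul h' g = h.
Proof.
exists (omul h (orth (orthogonal_tr (val_orthogonal g)))); apply: val_inj.
by rewrite /= -mulmxA (mulmx1C (val_orthogonal g)) mulmx1.
Qed.

Lemma iter_walk_omul k (F : O -> R) g :
  iter k (walk mu Phi) (fun h => F (omul h g)) =
  fun h => iter k (walk mu Phi) F (omul h g).
Proof.
elim: k => //= k ->; apply/funext => h; rewrite /walk.
do 3! congr (_ _ _); apply/funext => u.
by congr (iter _ _ _ _); apply: val_inj; rewrite /= mulmxA.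
Qed.

(** The mean is the limit functional on O(d) of [f] composed with the orbit map of one point;
    transitivity of the action turns strict positivity on O(d) into strict positivity on the
    sphere. *)
Lemma ex_invariant_mean : exists M : (S -> R) -> R,
  [/\ positive_functional val M,
      (forall f x, lip val f -> (forall y, 0 <= f y) -> 0 < f x -> 0 < M f) &
      forall g f, M (fun x => f (act x g)) = M f].
Proof.
pose lift (f : S -> R) (g : O) := f (act point g).
have lift_lip f : lip val f -> lip oiota (lift f).
  move=> /lip_klip[K K0 Kf]; exists K => g h.
  by rewrite (le_trans (Kf _ _))// ler_pM2l// act_dist.
have o1 : @orthogonal_mx R n.+1 1%:M by rewrite /orthogonal_mx /= trmx1 mulmx1.
have PhiX u g h : eucdist (oiota (Phi u g)) (oiota (Phi u h)) <=
    eucdist (oiota g) (oiota h) by rewrite omul_dist_l.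
have PhiS u v g : eucdist (oiota (Phi u g)) (oiota (Phi v g)) <=
    4 * eucdist (val u) (val v).
  rewrite omul_dist_r (le_trans _ (refl_mx_dist _ _)) ?dot_sphere//.
  by rewrite linearB.
have [LD LZ Lc Ll] := positive_ergodic_mean (orth o1) suppG PhiX PhiS
  enorm_orthogonal compact_oiota orefl_walk_irreducible.
exists (fun f => ergodic_mean mu Phi (lift f)); split.
- split => [f g lf lg|a f lf|c|f g lf lg fg].
  - by rewrite -LD//; exact: lift_lip.
  - by rewrite -LZ//; exact: lift_lip.
  - exact: Lc.
  - by apply: Ll; [exact: lift_lip|exact: lift_lip|move=> g'; exact: fg].
- move=> f x lf f0 fx; have [g gx] := sphere_transitive point x.
  apply: (ergodic_mean_gt0 (orth o1) suppG PhiX PhiS enorm_orthogonal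
    compact_oiota orefl_walk_irreducible (z := g)); first exact: lift_lip.
    by move=> h; exact: f0.
  by rewrite /lift gx.
- move=> g f; rewrite /ergodic_mean.
have -> : lift (fun x => f (act x g)) = fun h => lift f (omul h g).
  apply/funext => h; rewrite /lift; congr f.
  by apply: val_inj; rewrite /= mulmxA.
(* Right translation by [g] is onto and commutes with the walk, so both functions have the same
   uniform lower bounds. *)
congr sup; apply/seteqP; split => a [k ak]; exists k => h.
  by have [h' <-] := omulKr g h; have := ak h'; rewrite iter_walk_omul.
by rewrite iter_walk_omul.
Qed.

Hypothesis coverG : unit_sphere R n `<=` \bigcup_(u in G) halfspace (val u).

(* With [v] the mean of [psi x *: x], invariance under the reflection in [u]
   turns [2 (v . u)] into the mean of [(psi x - psi (R_u x)) (x . u)], which is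
   nonpositive for every [u] in [G]: the covering hypothesis forces [v = 0],
   hence all these functions vanish. *)
Lemma fold_superharmonic_refl (psi : S -> R) : lip val psi ->
  (forall u x, G u -> psi (sfold u x) <= psi x) ->
  forall u x, G u -> psi (act x (orefl u)) = psi x.
Proof.
move=> lpsi psiF; have [M [MP M0 Minv]] := ex_invariant_mean.
have [MD MZ Mc Ml] := MP.
have lp w : lip val (fun x : S => psi x * dot (val x) w).
  by apply: lipM lpsi (lip_dot _ _); exact: enorm_sphere.
pose v : 'rV[R]_n.+1 := \row_i M (fun x => psi x * dot (val x) (delta_mx 0 i)).
have Mv w : M (fun x => psi x * dot (val x) w) = dot v w.
  pose p i (x : S) := w 0 i * (psi x * dot (val x) (delta_mx 0 i)).
  have lpi i : lip val (p i) by apply/lipZ/lp.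
  have Mp i : M (p i) = v 0 i * w 0 i by rewrite MZ// mxE mulrC.
  rewrite dotE -(eq_bigr _ (fun i _ => Mp i)) -(functional_sum _ MP)//.
  congr M; apply/funext => x.
  rewrite dotE mulr_sumr; apply: eq_bigr => i _.
  by rewrite /p dot_delta mulrA mulrC.
pose h u x := (psi (act x (orefl u)) - psi x) * dot (val x) (val u).
have lact f u : lip val f -> lip val (fun x => f (act x (orefl u))).
  move=> /lip_klip[K K0 Kf]; exists K => x y.
  rewrite (le_trans (Kf _ _))// ler_pM2l// /eucdist /= -mulmxBl.
  by rewrite /enorm orthogonal_dot//; exact: (val_orthogonal (orefl u)).
have dot_act u x : dot (val (act x (orefl u))) (val u) = - dot (val x) (val u).
  by rewrite /= mul_refl_mx /refl !dot_lin dot_sphere; ring.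
have actK u x : act (act x (orefl u)) (orefl u) = x.
  by apply: val_inj; rewrite /= !mul_refl_mx reflK ?dot_sphere.
have sfoldN u x : dot (val x) (val u) <= 0 -> sfold u x = act x (orefl u).
  move=> xu; apply: val_inj; rewrite /= mul_refl_mx /fold ifF//.
  by apply/negP => /set_mem; rewrite /halfspace /= ltNge xu.
(* The two factors of [h u x] change sign together: the hypothesis is applied at the mirror image of
   [x] when [x] is on the positive side, and at [x] otherwise. *)
have h0 u x : G u -> 0 <= h u x.
  move=> Gu; rewrite /h; have [xu|xu] := leP 0 (dot (val x) (val u)).
    rewrite mulr_ge0// subr_ge0; have := psiF u (act x (orefl u)) Gu.
    by rewrite sfoldN ?actK// dot_act oppr_le0.
  by rewrite nmulr_lge0// subr_le0; have := psiF u x Gu; rewrite sfoldN// ltW.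
have lh u : lip val (h u).
  by apply: lipM (lip_dot _ _); [exact: enorm_sphere|apply: lipB => //; exact: lact].
have Mh u : M (h u) = - 2 * dot v (val u).
  pose q x := psi x * dot (val x) (val u).
  have lq a : lip val (fun x => a * q x) by apply/lipZ/lp.
  have lqa : lip val (fun x => q (act x (orefl u))) by exact/lact/lp.
  have -> : h u = fun x => -1 * q (act x (orefl u)) + -1 * q x.
    by apply/funext => x; rewrite /h /q dot_act; ring.
  rewrite MD; [|exact: lipZ|exact: lq].
  rewrite (MZ _ _ lqa) (MZ _ _ (lp _)) (Minv (orefl u) q) Mv; ring.
have v0 : v = 0.
  apply: contrapT => /eqP v0.
  have c0 : 0 < enorm v.
    by rewrite lt_def enorm_ge0 andbT; apply: contra v0 => /eqP/enorm_eq0 ->.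
  have [|u Gu] := coverG (_ : unit_sphere R n ((enorm v)^-1 *: v)).
    rewrite /unit_sphere /= dotZl dotZr -sqr_enorm; field; exact: lt0r_neq0.
  rewrite /halfspace /= dotZl pmulr_rgt0 ?invr_gt0// => vu.
  have := Ml _ _ (lip_cst _ 0) (lh u) (fun x => h0 u x Gu).
  by rewrite Mc Mh; lra.
move=> u x Gu; have Mh0 : M (h u) = 0 by rewrite Mh v0 -(scale0r 0) dotZl mul0r mulr0.
have hu0 : h u x = 0.
  apply/eqP; rewrite eq_le h0// andbT leNgt; apply/negP => hx.
  by have := M0 _ _ (lh u) (fun y => h0 u y Gu) hx; rewrite Mh0 ltxx.
move/eqP: hu0; rewrite mulf_eq0 subr_eq0 => /orP[/eqP//|/eqP xu0].
congr psi; apply: val_inj.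
by rewrite /= mul_refl_mx /refl xu0 mulr0 scale0r subr0.
Qed.

(** [psi] is invariant under the reflections, hence under a dense subgroup, hence by continuity
    under O(d), which acts transitively. *)
Lemma fold_superharmonic_cst (psi : S -> R) : lip val psi ->
  (forall u x, G u -> psi (sfold u x) <= psi x) -> forall x y, psi x = psi y.
Proof.
move=> lpsi psiF x y; have psiR := fold_superharmonic_refl lpsi psiF.
have [g <-] := sphere_transitive x y.
pose H := [set A : 'M[R]_n.+1 | forall x y : S, val y = val x *m A ->
  psi y = psi x].
have inH := @generated_subgroup_ind H _ _ _ _ _ (val_orthogonal g).
have [K K0 Kf] := lip_klip lpsi.
apply/eqP; rewrite -subr_eq0 -normr_le0; apply/ler_addgt0Pr => e e0; rewrite add0r.
have [|||||B [oB HB gB]] := inH _ _ _ _ (e / K).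
- by move=> u Gu {}x {}y xy; rewrite -(psiR u x Gu); congr psi; exact: val_inj.
- by move=> {}x {}y; rewrite mulmx1 => /val_inj ->.
- move=> A B oA oB HA HB {}x {}y xy; rewrite -(HA x (act x (orth oA)))//.
  by apply: HB; rewrite xy /= mulmxA.
- move=> A oA HA {}x {}y xy; apply/esym/HA.
  by rewrite xy -mulmxA (mulmx1C oA) mulmx1.
- by rewrite divr_gt0.
rewrite -(HB x (act x (orth oB)))// (le_trans (Kf _ _))// -ler_pdivlMl//.
rewrite mulrC (le_trans (act_dist _ _ _))// eucdistC ltW//.
Qed.

End invariant_mean.

(** * Mixtures of measures and joint measurability of folds *)

Section mixture.
Context d1 d2 d3 (T1 : measurableType d1) (T2 : measurableType d2)
  (T3 : measurableType d3) (R : realType).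
Variables (m1 : probability T1 R) (m2 : probability T2 R) (phi : T1 -> T2 -> T3).
Hypothesis mphi : measurable_fun [set: T1 * T2] (fun p => phi p.1 p.2).
Let phi2 (p : T1 * T2) := phi p.1 p.2.

Lemma product_preimageE (A : set T3) :
  (m1 \x m2)%E (phi2 @^-1` A) = (\int[m1]_x m2 (phi x @^-1` A))%E.
Proof.
apply: eq_integral => x _ /=; congr (m2 _).
by apply/seteqP; split => y; rewrite /xsection /= inE.
Qed.

(** As the image of the product measure under [phi], the mixture is countably additive at once. With
    folds for [phi] it realises [T_push] as a probability. *)
Lemma ex_mixture : exists nu : probability T3 R,
  forall A, nu A = (\int[m1]_x m2 (phi x @^-1` A))%E.
Proof.
exists (distribution (m1 \x m2)%E (mfun_Sub (mem_set mphi))) => A.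
by rewrite -product_preimageE.
Qed.

(** Tonelli with the order of integration exchanged: the variable of [m1], outermost in the
    definition of the mixture, is integrated first. *)
Lemma mean_mixture (nu : probability T3 R) (f : T3 -> R) :
  (forall A, measurable A -> nu A = (\int[m1]_x m2 (phi x @^-1` A))%E) ->
  bounded_meas f -> (forall z, 0 <= f z) ->
  (forall y, bounded_meas (fun x => f (phi x y))) ->
  bounded_meas (fun y => mean m1 (fun x => f (phi x y))) ->
  mean nu f = mean m2 (fun y => mean m1 (fun x => f (phi x y))).
Proof.
move=> nuE bf f0 bfy bm; apply: EFin_inj; rewrite !EFin_mean//.
have mf : measurable_fun [set: T3] (EFin \o f) by exact/measurable_EFinP/bf.1.
transitivity (\int[pushforward (m1 \x m2)%E phi2]_z (f z)%:E)%E.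
  apply: eq_measure_integral => A mA _.
  exact: (etrans (nuE A mA) (esym (product_preimageE A))).
rewrite ge0_integral_pushforward//; last by move=> z _; rewrite lee_fin.
rewrite preimage_setT fubini_tonelli2/=.
- by apply: eq_integral => y _; rewrite /fubini_G/= EFin_mean.
- exact: measurableT_comp.
- by move=> p; rewrite lee_fin.
Qed.

End mixture.

(** * Joint measurability of the fold in direction and point *)

Section sphere_product.
Context {R : realType} {n : nat}.
Local Notation S := (sphere R n).
Implicit Types (u x : S).

Definition sball x (e : R) : set S := [set y | eucdist (val x) (val y) < e].

Lemma open_sball x e : open (sball x e).
Proof.
apply/sphere_openP => y xy; exists (e - eucdist (val x) (val y)).
  by rewrite subr_gt0.
move=> z yz; rewrite /sball /= (le_lt_trans (eucdist_triangle (val y) _ _))//.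
by rewrite -ltrBrDl.
Qed.

Lemma sphere_net e : 0 < e -> exists s : seq S,
  forall x, exists2 p, p \in s & eucdist (val p) (val x) < e.
Proof.
move=> e0; have := @compact_sphere R n; rewrite compact_cover.
move=> /(_ S setT (fun x => sball x e))[||s _ sub].
- by move=> x _; exact: open_sball.
- by move=> x _; exists x => //; rewrite /sball /= eucdistxx.
by exists (finmap.enum_fset s) => x; have [p ps xp] := sub x I; exists p.
Qed.

(** Measurability refers to the product sigma-algebra, so an open set must be exhibited as a
    countable union of rectangles; their centres come from finite nets of mesh 1/(k+1). *)
Lemma measurable_open2 (W : set (S * S)) :
  (forall p, W p -> exists2 r, 0 < r & forall q,
    eucdist (val p.1) (val q.1) < r -> eucdist (val p.2) (val q.2) < r -> W q) ->
  measurable W.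
Proof.
move=> oW; pose e k : R := k.+1%:R^-1.
have e0 k : 0 < e k by rewrite invr_gt0.
have /choice[s sP] := fun k => sphere_net (e0 k).
pose rect k (p : S * S) := sball p.1 (e k) `*` sball p.2 (e k).
pose rectW k p := if pselect (rect k p `<=` W) then rect k p else set0.
have -> : W = \bigcup_k \big[setU/set0]_(p <- [seq (p, q) | p <- s k, q <- s k]) rectW k p.
  apply/seteqP; split=> [[u x] Wux|q [k _]]; last first.
    rewrite -bigcup_seq => -[p _]; rewrite /rectW; case: pselect => // sub.
    exact: sub.
  have [r r0 rW] := oW _ Wux.
  have [k kr] : exists k, e k < r / 2.
    have r2 : 0 < r / 2 by rewrite divr_gt0.
    by have [k] := ltr_add_invr r2; rewrite add0r; exists k.
  have [p pk up] := sP k u; have [q qk xq] := sP k x.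
  exists k => //; rewrite -bigcup_seq; exists (p, q); first exact: allpairs_f.
  rewrite /rectW; case: (pselect (rect k (p, q) `<=` W)) => [sub|nsub]; first by split.
  exfalso; apply: nsub => z [pv qy]; apply: rW => /=.
    rewrite (le_lt_trans (eucdist_triangle (val p) _ _))// eucdistC.
    by move: pv; rewrite /sball /=; lra.
  rewrite (le_lt_trans (eucdist_triangle (val q) _ _))// eucdistC.
  by move: qy; rewrite /sball /=; lra.
apply: bigcupT_measurable => k; apply: bigsetU_measurable => p _.
rewrite /rectW; case: pselect => [sub|nsub]; last exact: measurable0.
by apply: measurableX; apply: open_measurable_sphere; exact: open_sball.
Qed.

Lemma measurable_sfold :
  measurable_fun [set: S * S] (fun p : S * S => sfold p.1 p.2).
Proof.
move=> _; apply: (measurability (@open S)) => //.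
move=> _ [U oU <-]; rewrite setTI; apply: measurable_open2 => -[u x] Uux.
have [r r0 rU] := (sphere_openP U).1 oU _ Uux.
(* 5 = 4 + 1, the sum of the Lipschitz constants in the direction and in the point. *)
exists (r / 5) => [|[v y] /= uv xy]; first by rewrite divr_gt0.
apply: rU; rewrite /= (le_lt_trans (eucdist_triangle (fold (val v) (val x)) _ _))//.
have := fold_eucdist_dir (dot_sphere v) (dot_sphere u) (dot_sphere x).
have := fold_eucdist (val x) (val y) (dot_sphere v).
lra.
Qed.

End sphere_product.

(** * The fold walk on the sphere *)

Section fold_walk.
Context {R : realType} {n : nat} (mu : probability (sphere R n) R).
Local Notation S := (sphere R n).
Context (G : set S).
Hypothesis suppG : forall u (U : set S), G u -> open U -> U u -> (0 < mu U)%E.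
Hypothesis denseG : @orthogonal_mx R n.+1 `<=`
  closure (generated_subgroup [set refl_mx (val u) | u in G]).
Hypothesis coverG : unit_sphere R n `<=` \bigcup_(u in G) halfspace (val u).
Implicit Types (u x y : S) (f : S -> R).

Lemma sfold_eucdist u x y :
  eucdist (val (sfold u x)) (val (sfold u y)) <= eucdist (val x) (val y).
Proof. exact: fold_eucdist (dot_sphere u). Qed.

Lemma sfold_eucdist_dir u v x :
  eucdist (val (sfold u x)) (val (sfold v x)) <= 4 * eucdist (val u) (val v).
Proof. exact: fold_eucdist_dir (dot_sphere v) (dot_sphere u) (dot_sphere x). Qed.

(** The same folds are run from [x']. This coupling makes the supremum in the next proof Lipschitz
    with the constant of [f]. *)
Lemma reach_close x x' y : reach G sfold x y ->
  exists2 y', reach G sfold x' y' &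
    eucdist (val y) (val y') <= eucdist (val x) (val x').
Proof.
move=> xy; elim: xy x' => [{}x|u {}x {}y Gu _ IH] x'.
  by exists x' => //; exact: reach0.
have [y' xy' yy'] := IH (sfold u x'); exists y'; first exact: reachS xy'.
exact: le_trans yy' (sfold_eucdist u x x').
Qed.

(* The supremum of [f] over the points reachable from [x] can only decrease
   along folds, so it is constant by rigidity. *)
Lemma sfold_irreducible : irreducible G val (sfold (R := R) (n := n)).
Proof.
move=> f z /[dup] lf /lip_klip[K K0 Kf] f0 fz x.
have [M M0 fM] := lip_bounded enorm_sphere lf.
pose E x := [set f y | y in [set y | reach G sfold x y]].
have supE y : has_sup (E y).
  split; first by exists (f y), y => //; exact: reach0.
  by exists M => _ [y' _ <-]; exact: le_trans (ler_norm _) (fM y').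
have le_sup y y' : reach G sfold y y' -> f y' <= sup (E y).
  by move=> yy'; apply: ub_le_sup; [exact: (supE y).2|exists y'].
have lpsi : lip val (fun y => sup (E y)).
  exists K; apply: klipP => y y'; apply: ge_sup; first exact: (supE y).1.
  move=> _ [w yw <-]; have [w' y'w' ww'] := reach_close y' yw.
  rewrite (le_trans (klip_le w w' Kf))// lerD ?le_sup//.
  by rewrite ler_pM2l.
have psiF u y : G u -> sup (E (sfold u y)) <= sup (E y).
  move=> Gu; apply: ge_sup; first exact: (supE _).1.
  by move=> _ [w yw <-]; apply: le_sup; exact: reachS yw.
have psi_gt0 : 0 < sup (E x).
  rewrite (fold_superharmonic_cst suppG denseG coverG lpsi psiF x z).
  by apply: lt_le_trans fz _; apply: le_sup; exact: reach0.
have [_ [y xy <-]] := sup_adherent psi_gt0 (supE x).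
by rewrite subrr => fy; exists y.
Qed.

Definition fold_mean f : R := ergodic_mean mu sfold f.

Let compact_val : compact (range (val : S -> 'rV[R]_n.+1)).
Proof.
rewrite (_ : range _ = unit_sphere R n); first exact: compact_unit_sphere.
apply/seteqP; split=> [_ [x _ <-]|x Sx]; first exact: dot_sphere.
by exists (SigSub (mem_set Sx) : set_type (unit_sphere R n)).
Qed.

Lemma positive_fold_mean : positive_functional val fold_mean.
Proof.
exact: (positive_ergodic_mean point suppG sfold_eucdist sfold_eucdist_dir
  enorm_sphere compact_val sfold_irreducible).
Qed.

Lemma fold_mean_gt0 f x : lip val f -> (forall y, 0 <= f y) -> 0 < f x ->
  0 < fold_mean f.
Proof.
exact: (ergodic_mean_gt0 point suppG sfold_eucdist sfold_eucdist_dir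
  enorm_sphere compact_val sfold_irreducible).
Qed.

Lemma fold_mean_walk f : lip val f -> fold_mean (walk mu sfold f) = fold_mean f.
Proof.
exact: (ergodic_mean_walk point suppG sfold_eucdist sfold_eucdist_dir
  enorm_sphere compact_val sfold_irreducible).
Qed.

Lemma fold_walk_cvg f e : lip val f -> 0 < e -> exists k, forall x,
  `|iter k (walk mu sfold) f x - fold_mean f| <= e.
Proof.
move=> lf e0.
have [k Hk] := walk_cvg point suppG sfold_eucdist sfold_eucdist_dir
  enorm_sphere compact_val sfold_irreducible lf e0.
by exists k; exact: Hk.
Qed.

Lemma lip_fold_mean f : lip val f -> lip val (fun x => mean mu (fun u => f (sfold u x))).
Proof.
move=> lf; rewrite (_ : (fun _ => _) = fun x => 2 * walk mu sfold f x - f x).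
  apply: lipB => //; apply: lipZ.
  exact: (lip_walk mu sfold_eucdist sfold_eucdist_dir).
by apply/funext => x; rewrite /walk; lra.
Qed.

Lemma mean_T_push (rho nu : probability S R) f :
  (forall A, measurable A -> nu A = T_push mu rho A) -> lip val f ->
  mean nu f = 2 * mean rho (walk mu sfold f) - mean rho f.
Proof.
move=> nuE lf.
suff E : mean nu f = mean rho (fun x => mean mu (fun u => f (sfold u x))).
  have lw := lip_walk mu sfold_eucdist sfold_eucdist_dir lf.
  have [mD mZ _ _] := positive_mean rho.
  rewrite E -mulN1r -!mZ// -mD; [|exact: lipZ|exact: lipZ].
  by congr mean; apply/funext => x; rewrite /walk; lra.
(* Tonelli is applied to a nonnegative integrand, so [f] is shifted by a bound [M], which cancels on
   both sides. *)
have [M M0 fM] := lip_bounded enorm_sphere lf.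
have lfM : lip val (fun x => f x + M) by apply: lipD => //; exact: lip_cst.
have orb g x : lip val g -> lip val (fun u => g (sfold u x)).
  exact: (orbit_lip sfold_eucdist_dir).
have mE (P : probability S R) g : lip val g -> mean P (fun x => g x + M) = mean P g + M.
  have [mD _ mc _] := positive_mean P.
  by move=> lg; rewrite mD ?mc//; exact: lip_cst.
have innerE : (fun x => mean mu (fun u => f (sfold u x) + M)) =
    fun x => mean mu (fun u => f (sfold u x)) + M.
  by apply/funext => x; rewrite mE//; exact: (orb f x).
apply: (@addIr _ M); rewrite -!mE//; last exact: lip_fold_mean.
rewrite -innerE; apply: mean_mixture => //.
- exact: measurable_sfold.
- exact: bounded_meas_lip.
- by move=> z; have := fM z; rewrite ler_norml => /andP[? _]; lra.
- by move=> y; apply: bounded_meas_lip; exact: (orb (fun x => f x + M) y).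
- by rewrite innerE; apply: bounded_meas_lip; apply: lipD (lip_cst _ _); exact: lip_fold_mean.
Qed.

(** The mean under [rho] is unchanged by the walk, while the iterates of [f] tend uniformly to the
    constant [fold_mean f]. *)
Lemma stationary_mean (rho : probability S R) f :
  (forall A, measurable A -> T_push mu rho A = rho A) -> lip val f ->
  mean rho f = fold_mean f.
Proof.
move=> rhoT lf; have lw := lip_walk mu sfold_eucdist sfold_eucdist_dir.
have rho_walk g : lip val g -> mean rho (walk mu sfold g) = mean rho g.
  by move=> lg; have := @mean_T_push rho rho g (fun A mA => esym (rhoT A mA)) lg; lra.
have rho_iter k : mean rho (iter k (walk mu sfold) f) = mean rho f.
  elim: k => //= k IH; rewrite rho_walk ?IH//.
  exact: (lip_iter_walk mu sfold_eucdist sfold_eucdist_dir).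
have [_ _ mc ml] := positive_mean rho.
apply/eqP; rewrite -subr_eq0 -normr_le0; apply/ler_addgt0Pr => e e0; rewrite add0r.
have [k Hk] := fold_walk_cvg lf e0; rewrite -(rho_iter k).
have lk := lip_iter_walk mu sfold_eucdist sfold_eucdist_dir k lf.
have h1 : fold_mean f - e <= mean rho (iter k (walk mu sfold) f).
  rewrite -[leLHS]mc; apply: ml => // [|x]; first exact: lip_cst.
  by have := Hk x; rewrite ler_norml => /andP[? ?]; lra.
have h2 : mean rho (iter k (walk mu sfold) f) <= fold_mean f + e.
  rewrite -[leRHS]mc; apply: ml => // [|x]; first exact: lip_cst.
  by have := Hk x; rewrite ler_norml => /andP[? ?]; lra.
by rewrite ler_norml; apply/andP; split; lra.
Qed.

End fold_walk.

(** * Riesz representation on the sphere *)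

Section riesz.
Context {R : realType} {n : nat}.
Local Notation S := (sphere R n).
Variable L : (S -> R) -> R.
Hypothesis LP : positive_functional val L.
Implicit Types (f g : S -> R) (U V A B : set S) (x : S).

(** The test functions vanish outside [U] instead of having support inside it; cutting them at
    height [e] with [trunc] supplies the room that compact support would give. *)
Definition below U f := [/\ lip val f, forall x, 0 <= f x & forall x, f x <= \1_U x].

Lemma below0 U : below U (fun=> 0).
Proof. by split => //; exact: lip_cst. Qed.

Lemma below_sub U V f : U `<=` V -> below U f -> below V f.
Proof.
move=> UV [lf f0 fU]; split=> // x; rewrite (le_trans (fU x))// !indicE.
have [/set_mem/UV/mem_set ->//|_] := boolP (x \in U); exact: ler0n.
Qed.

Lemma below_le1 U f x : below U f -> f x <= 1.
Proof. by case=> _ _ /(_ x)/le_trans; apply; rewrite indicE lern1 leq_b1. Qed.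

Lemma below_notin U f x : below U f -> ~ U x -> f x = 0.
Proof.
move=> [_ f0 fU] Ux; apply/eqP; rewrite eq_le f0 andbT.
by rewrite (le_trans (fU x))// indicE memNset.
Qed.

Lemma belowP U f : lip val f -> (forall x, 0 <= f x <= 1) ->
  (forall x, 0 < f x -> U x) -> below U f.
Proof.
move=> lf f01 fU; split=> // x; have /andP[f0 f1] := f01 x => //.
have [Ux|Ux] := boolP (x \in U); first by rewrite indicE Ux.
rewrite indicE (negbTE Ux) leNgt; apply/negP => /fU.
by move/mem_set; rewrite (negbTE Ux).
Qed.

Lemma L_below_le1 U f : below U f -> L f <= 1.
Proof.
move=> fU; have [_ _ Lc Ll] := LP; rewrite -(Lc 1); have [lf _ _] := fU.
by apply: Ll => //; [exact: lip_cst|move=> x; exact: below_le1 fU].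
Qed.

Definition content U : R := sup [set L f | f in below U].

Lemma has_sup_content U : has_sup [set L f | f in below U].
Proof.
split; first by exists (L (fun=> 0)), (fun=> 0) => //; exact: below0.
by exists 1 => _ [f fU <-]; exact: L_below_le1 fU.
Qed.

Lemma content_ge U f : below U f -> L f <= content U.
Proof. by move=> fU; apply: ub_le_sup; [exact: (has_sup_content U).2|exists f]. Qed.

Lemma content_le U r : (forall f, below U f -> L f <= r) -> content U <= r.
Proof.
move=> Ur; apply: ge_sup; first exact: (has_sup_content U).1.
by move=> _ [f fU <-]; exact: Ur.
Qed.

Lemma content_ge0 U : 0 <= content U.
Proof.
have [_ _ Lc _] := LP; rewrite -(Lc 0); exact/content_ge/below0.
Qed.

Lemma content_le1 U : content U <= 1.
Proof. by apply: content_le => f; exact: L_below_le1. Qed.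

Lemma le_content U V : U `<=` V -> content U <= content V.
Proof. by move=> UV; apply: content_le => f /(below_sub UV)/content_ge. Qed.

Lemma content0 : content set0 = 0.
Proof.
have [_ _ Lc _] := LP; apply/eqP; rewrite eq_le content_ge0 andbT.
apply: content_le => f f0; rewrite (_ : f = fun=> 0) ?Lc//.
by apply/funext => x; apply: below_notin f0 _.
Qed.

Lemma contentT : content setT = 1.
Proof.
have [_ _ Lc _] := LP; apply/eqP; rewrite eq_le content_le1 -(Lc 1).
apply: content_ge; split => //; first exact: lip_cst.
by move=> x; rewrite indicT.
Qed.

Let trunc e f x := Num.max 0 (f x + - e).

Let lip_trunc e f : lip val f -> lip val (trunc e f).
Proof. by move=> lf; apply/lip_max/lipD => //; exact: lip_cst. Qed.

Let L_trunc e f : lip val f -> L f - e <= L (trunc e f).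
Proof.
move=> lf; have [LD _ Lc Ll] := LP; rewrite -[in leLHS](Lc (- e)) -LD//.
  apply: Ll => [||x]; [apply: lipD => //; exact: lip_cst|exact: lip_trunc|].
  by rewrite /trunc le_max lexx orbT.
exact: lip_cst.
Qed.

Lemma sphere_increasing_cover (U : nat -> set S) :
  (forall k, U k `<=` U k.+1) -> (forall k, open (U k)) ->
  (forall x, exists k, U k x) -> exists k, forall x, U k x.
Proof.
move=> Uincr Uopen Ucov.
have [||||k Uk] := @compact_increasing_cover R _ (unit_sphere R n)
  (fun k => val @` U k).
- exact: compact_unit_sphere.
- by move=> k _ _ [x Ux <-]; exists x => //; exact: Uincr.
- move=> k _ _ [x Ux <-]; have [r r0 rU] := (sphere_openP _).1 (Uopen k) x Ux.
  exists r => // y Sy xy.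
  by exists (SigSub (mem_set Sy) : set_type (unit_sphere R n)) => //; exact: rU.
- move=> x Sx; pose y : S := (SigSub (mem_set Sx) : set_type (unit_sphere R n)).
  by have [k Uky] := Ucov y; exists k, y.
exists k => x; have [y Uky /val_inj <-//] := Uk _ (dot_sphere x).
Qed.

(** Explicit Urysohn functions: as [a] grows they increase to the indicator of [U] when [U] is
    open. *)
Lemma below_setdist U (a : R) : 0 <= a ->
  below U (fun x => Num.min 1 (a * setdist val U x)).
Proof.
move=> a0; apply: belowP.
- by apply/lip_min/lipZ/(ex_intro _ 1)/klip_setdist; exact: lip_cst.
- by move=> x; rewrite le_min ler01 mulr_ge0 ?setdist_ge0//= ge_min lexx.
- move=> x; apply: contraPP => Ux; rewrite setdist0// mulr0.
  by rewrite lt_min ltxx andbF.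
Qed.

Lemma content_bigcup_le (U : nat -> set S) f e : (forall i, open (U i)) ->
  below (\bigcup_i U i) f -> 0 < e ->
  exists N, L f <= e + \sum_(i < N) content (U i).
Proof.
move=> oU fU e0; have [lf f0 _] := fU.
(* One index [k] bounds both the number of sets and the slope of the bumps, which makes [W]
   increasing. On [W N] either the truncation of [f] vanishes or one of the first [N] bumps equals
   1. *)
pose W k := [set x | f x < e \/ exists2 i, (i < k)%N & 1 < k%:R * setdist val (U i) x].
have [|||N WN] := @sphere_increasing_cover W.
- move=> k x [|[i ik fx]]; [by left|right]; exists i; first exact: ltnW.
  by rewrite (lt_le_trans fx)// ler_wpM2r ?setdist_ge0// ler_nat.
- move=> k; rewrite (_ : W k = [set x | - e < -1 * f x] `|`
    \bigcup_(i < k) [set x | 1 < k%:R * setdist val (U i) x]).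
    apply: openU; first by apply: open_lip_gt; exact: lipZ.
    apply: bigcup_open => i _; apply: open_lip_gt; apply: lipZ.
    by exists 1; exact: klip_setdist.
  apply/seteqP; split => x; rewrite /W /= mulN1r ltrN2.
    by case=> [|[i ik ix]]; [left|right; exists i].
  by case=> [|[i ik ix]]; [left|right; exists i].
- move=> x; have [fx|fx] := ltP (f x) e; first by exists 0%N; left.
  have [i _ Uix] : (\bigcup_i U i) x.
    apply: contrapT => nU; have := below_notin fU nU; move: e0 fx; lra.
  have [r r0 rU] := (sphere_openP _).1 (oU i) x Uix.
  have d0 := setdist_gt0 r0 rU.
  have [k kd] := ltr_add_invr d0; rewrite add0r in kd.
  exists (i + k).+1; right; exists i; first by rewrite ltnS leq_addr.
  rewrite -ltr_pdivrMl// mulr1; apply: le_lt_trans kd.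
  by rewrite lef_pV2 ?posrE// ler_nat ltnS leq_addl.
exists N; have [_ _ _ Ll] := LP.
pose bump i x := Num.min 1 (N%:R * setdist val (U i) x).
have bN i : below (U i) (bump i) := below_setdist (U i) (ler0n R N).
rewrite -lerBlDl (le_trans (L_trunc e lf))//.
apply: (@le_trans _ _ (L (fun x => \sum_(i < N) bump i x))).
  apply: Ll; [exact: lip_trunc|apply: lip_sum => i; by have [] := bN i|].
  move=> x; have s0 : 0 <= \sum_(i < N) bump i x.
    by apply: sumr_ge0 => i _; have [_ ->] := bN i.
  rewrite /trunc ge_max s0/=; have [fx|[i iN ix]] := WN x.
    by apply: le_trans s0; rewrite subr_le0 ltW.
  rewrite (bigD1 (Ordinal iN))//= -[leLHS]addr0 lerD//.
    rewrite /bump (min_idPl (ltW ix)); have := below_le1 x fU; lra.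
  by apply: sumr_ge0 => j _; have [_ ->] := bN j.
rewrite (functional_sum _ LP); last by move=> i; have [] := bN i.
by apply: ler_sum => i _; exact: content_ge.
Qed.

Definition outer_content A : R := inf [set content U | U in [set U | open U /\ A `<=` U]].

Lemma has_inf_outer A : has_inf [set content U | U in [set U | open U /\ A `<=` U]].
Proof.
split; first by exists (content setT), setT => //; split => //; exact: openT.
by exists 0 => _ [U _ <-]; exact: content_ge0.
Qed.

Lemma outer_content_le A U : open U -> A `<=` U -> outer_content A <= content U.
Proof. by move=> oU AU; apply: ge_inf; [exact: (has_inf_outer A).2|exists U]. Qed.

Lemma outer_content_ge A r : (forall U, open U -> A `<=` U -> r <= content U) ->
  r <= outer_content A.
Proof.
move=> rA; apply: lb_le_inf; first exact: (has_inf_outer A).1.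
by move=> _ [U [oU AU] <-]; exact: rA.
Qed.

Lemma outer_content_open U : open U -> outer_content U = content U.
Proof.
move=> oU; apply/eqP; rewrite eq_le outer_content_le//=.
by apply: outer_content_ge => V _; exact: le_content.
Qed.

Lemma outer_content_ge0 A : 0 <= outer_content A.
Proof. by apply: outer_content_ge => U _ _; exact: content_ge0. Qed.

Lemma outer_content_adherent A e : 0 < e ->
  exists U, [/\ open U, A `<=` U & content U < outer_content A + e].
Proof.
by move=> e0; have [_ [U [oU AU] <-] Ue] := inf_adherent e0 (has_inf_outer A); exists U.
Qed.

Definition outer A : \bar R := (outer_content A)%:E.

Let outer0 : outer set0 = 0%E.
Proof. by rewrite /outer outer_content_open ?content0//; exact: open0. Qed.

Let outer_ge0 A : (0 <= outer A)%E.
Proof. by rewrite lee_fin outer_content_ge0. Qed.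

Let le_outer : {homo outer : A B / A `<=` B >-> (A <= B)%E}.
Proof.
move=> A B AB; rewrite lee_fin; apply: outer_content_ge => U oU BU.
by apply: outer_content_le => //; exact: subset_trans BU.
Qed.

Let outer_sigma_subadditive : sigma_subadditive outer.
Proof.
move=> F; apply/lee_addgt0Pr => e e0.
have F0 i : xpredT i -> (0 <= outer (F i))%E by [].
apply: le_trans (epsilon_trick xpredT (fun i => outer_ge0 (F i)) (ltW e0)).
have ei i : 0 < e / (2 ^ i.+1)%:R by rewrite divr_gt0// ltr0n expn_gt0.
have /choice[U UP] := fun i => outer_content_adherent (F i) (ei i).
have oU i : open (U i) by have [] := UP i.
have oUU : open (\bigcup_i U i) by exact: bigcup_open.
apply: (@le_trans _ _ (content (\bigcup_i U i))%:E).
  rewrite lee_fin; apply: outer_content_le => // x [i _ Fx]; exists i => //.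
  by have [_ FU _] := UP i; exact: FU.
apply: (@le_trans _ _ (\sum_(i <oo) (content (U i))%:E)%E); last first.
  apply: lee_nneseries => [i _ _|i _]; first by rewrite lee_fin content_ge0.
  by rewrite -EFinD lee_fin ltW//; have [] := UP i.
have Lle f : below (\bigcup_i U i) f ->
    ((L f)%:E <= \sum_(i <oo) (content (U i))%:E)%E.
  move=> fU; apply/lee_addgt0Pr => r r0.
  have [N HN] := content_bigcup_le oU fU r0.
  apply: (@le_trans _ _ (r%:E + \sum_(0 <= i < N) (content (U i))%:E)%E).
    by rewrite sumEFin -EFinD lee_fin big_mkord.
  rewrite addeC leeD2r//; apply: nneseries_lim_ge => i _ _.
  by rewrite lee_fin content_ge0.
move: Lle; case: (\sum_(i <oo) _)%E => [s||] Lle; rewrite ?leey//.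
  by rewrite lee_fin; apply: content_le => f /Lle; rewrite lee_fin.
by have := Lle _ (below0 _); rewrite leeNy_eq.
Qed.

HB.instance Definition _ := isOuterMeasure.Build R S outer
  outer0 outer_ge0 le_outer outer_sigma_subadditive.

(** For [f] below [U] intersected with [V] and [g] below the part of [U] where [f < e], the
    truncation of [f] and [g] are never both nonzero, so their sum is again below [U]. Truncating
    costs only [e]. *)
Lemma outer_caratheodory_open V : open V -> outer.-caratheodory V.
Proof.
move=> oV; apply: le_caratheodory_measurable => X; rewrite -EFinD lee_fin.
apply: outer_content_ge => U oU XU; rewrite -lerBrDr.
have oUV : open (U `&` V) by exact: openI.
apply: le_trans (outer_content_le oUV _) _.
  by move=> x [/XU Ux Vx]; split.
apply: content_le => f fUV; have [lf f0 _] := fUV.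
rewrite lerBrDr; apply/ler_addgt0Pr => e e0.
pose W := U `&` [set x | - e < -1 * f x].
have oW : open W by apply: openI => //; apply: open_lip_gt; exact: lipZ.
have XW : X `&` ~` V `<=` W.
  move=> x [/XU Ux Vx]; split => //=; rewrite (below_notin fUV); first by lra.
  by case.
suff: L f - e + content W <= content U.
  have := outer_content_le oW XW; lra.
rewrite -lerBrDl; apply: content_le => g gW; rewrite lerBrDl.
have [lg g0 _] := gW; have lt := lip_trunc e lf.
apply: le_trans (lerD (L_trunc e lf) (lexx _)) _.
have [LD _ _ _] := LP; rewrite -LD//; apply: content_ge.
have gf x : e <= f x -> g x = 0.
  by move=> ef; apply: (below_notin gW) => -[_ /=]; lra.
have t0 x : 0 <= trunc e f x by rewrite le_max lexx.
apply: belowP => [|x|x]; first exact: lipD.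
  rewrite addr_ge0//=; have [fx|fx] := leP e (f x).
    by rewrite gf// addr0 ge_max ler01/=; have := below_le1 x fUV; lra.
  rewrite /trunc (max_idPl _) ?add0r ?(below_le1 x gW)//; lra.
have [fx|fx] := leP e (f x).
  move=> _; apply: contrapT => Ux.
  have : f x = 0 by apply: (below_notin fUV) => -[].
  lra.
rewrite /trunc (max_idPl _) ?add0r; last by lra.
by move=> gx; apply: contrapT => Ux; rewrite (below_notin gW) ?ltxx// in gx => -[].
Qed.

Lemma outer_caratheodory A : measurable A -> outer.-caratheodory A.
Proof.
apply: smallest_sub; last by move=> U; exact: outer_caratheodory_open.
split; first exact: caratheodory_measurable_set0.
- by move=> B mB; rewrite setTD; exact: caratheodory_measurable_setC.
- exact: caratheodory_measurable_bigcup.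
Qed.

Definition riesz (A : set S) : \bar R := outer A.

Let riesz0 : riesz set0 = 0%E. Proof. exact: outer0. Qed.

Let riesz_ge0 A : (0 <= riesz A)%E. Proof. exact: outer_ge0. Qed.

Let riesz_sigma_additive : semi_sigma_additive riesz.
Proof.
move=> F mF tF mUF; apply: (@caratheodory_measure_sigma_additive R S outer) => //.
  by move=> i; apply: outer_caratheodory; exact: mF.
exact: outer_caratheodory.
Qed.

HB.instance Definition _ := isMeasure.Build _ S R riesz
  riesz0 riesz_ge0 riesz_sigma_additive.

Let rieszT : riesz setT = 1%E.
Proof.
by rewrite /riesz /outer outer_content_open ?contentT//; exact: openT.
Qed.

HB.instance Definition _ := Measure_isProbability.Build _ S R riesz rieszT.

Definition riesz_probability : probability S R := riesz.

Lemma riesz_open U : open U -> riesz U = (content U)%:E.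
Proof. by move=> oU; rewrite /riesz /outer outer_content_open. Qed.

Lemma outer_contentC A : measurable A -> outer_content A + outer_content (~` A) = 1.
Proof.
move=> mA; have := outer_caratheodory mA setT; rewrite !setTI /outer -EFinD.
by rewrite outer_content_open ?contentT; [case|exact: openT].
Qed.

Lemma regular_riesz : regular_measure riesz_probability.
Proof.
move=> A mA; rewrite /riesz_probability; split; apply/eqP; rewrite eq_le; apply/andP; split.
- by apply: le_ereal_inf_tmp => _ [U [_ AU] <-]; exact: le_outer.
- apply/lee_addgt0Pr => e e0.
  have [U [oU AU Ue]] := outer_content_adherent A e0.
  apply: (@le_trans _ _ (riesz U)); first by apply: ereal_inf_lbound; exists U.
  by rewrite riesz_open// -EFinD lee_fin ltW.
(* Inner regularity by complements: an open set just larger than the complement of [A] has a compact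
   complement inside [A]. *)
- apply/lee_addgt0Pr => e e0.
  have [U [oU AU Ue]] := outer_content_adherent (~` A) e0.
  have mU := open_measurable_sphere oU.
  apply: (@le_trans _ _ (riesz (~` U) + e%:E)%E).
    rewrite -EFinD lee_fin; have := outer_contentC mA; have := outer_contentC mU.
    by rewrite outer_content_open//; lra.
  rewrite leeD2r//; apply: ereal_sup_ubound; exists (~` U) => //; split.
    by apply: (subclosed_compact _ (@compact_sphere R n)) => //; exact: open_closedC.
  by move=> x nUx; apply: contrapT => nAx; exact: nUx (AU _ nAx).
- by apply: ge_ereal_sup => _ [K [_ KA] <-]; exact: le_outer.
Qed.

Let clip (t : R) := Num.max 0 (Num.min 1 t).

Let sum_clip (y : R) N : 0 <= y ->
  \sum_(j < N) clip (y - j%:R) = Num.min y N%:R.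
Proof.
move=> y0; elim: N => [|N IH]; first by rewrite big_ord0 (min_idPr y0).
rewrite big_ord_recr/= IH /clip -[N.+1%:R]natr1.
have := ler0n R N; set m := N%:R => m0.
have [?|?] := leP y m; have [?|?] := leP y (m + 1);
  (have [?|?] := leP 1 (y - m); [rewrite (max_idPr ler01); lra|]);
  have [?|?] := leP 0 (y - m); lra.
Qed.

(* Layer cake: each layer [clip (N f - j)] is bounded by the indicator of
   [f > j / N], which is at most the previous layer. *)
Lemma le_mean_riesz01 f : lip val f -> (forall x, 0 <= f x <= 1) ->
  L f <= mean riesz_probability f.
Proof.
move=> lf f01; have [LD LZ Lc Ll] := LP.
have MP := positive_mean riesz_probability; have [mD mZ mc ml] := MP.
apply/ler_addgt0Pr => e e0; have [N Ne] := ltr_add_invr e0; rewrite add0r in Ne.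
pose c j x := clip (N.+1%:R * f x + - j%:R).
have lc j : lip val (c j).
  apply/lip_max/lip_min/lipD/lip_cst/lipZ => //; exact: lip_cst.
have c0 j x : 0 <= c j x by rewrite le_max lexx.
have c1 j x : c j x <= 1 by rewrite ge_max ler01/= ge_min lexx.
have fE : f = fun x => N.+1%:R^-1 * \sum_(j < N.+1) c j x.
  apply/funext => x; have /andP[fx0 fx1] := f01 x.
  rewrite sum_clip ?mulr_ge0// (min_idPl _) ?mulKf//.
  by rewrite ler_piMr.
have layer j : L (c j.+1) <= mean riesz_probability (c j).
  pose U := [set x | j.+1%:R < N.+1%:R * f x].
  have oU : open U by apply: open_lip_gt; exact: lipZ.
  apply: (@le_trans _ _ (content U)).
    apply: content_ge; apply: belowP => // [x|x]; first by rewrite c0 c1.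
    by rewrite /c /clip lt_max ltxx/= lt_min ltr01/= subr_gt0.
  rewrite -lee_fin -riesz_open//.
  have := @measure_le_mean _ _ _ riesz_probability (c j) U 1
    (bounded_meas_lip (lc j)) (open_measurable_sphere oU) (c0 j) ler01 _.
  rewrite mul1e; apply => x; rewrite /U /= -natr1 /c /clip => jx.
  by rewrite le_max le_min lexx/=; apply/orP; right; lra.
rewrite [in L f]fE LZ; last exact: lip_sum.
rewrite (functional_sum _ LP)// big_ord_recl/=.
(* The lowest layer has no predecessor; after division by [N.+1] it contributes less than [e]. *)
have Lc0 : L (c 0%N) <= 1 by rewrite -(Lc 1); apply: Ll => //; exact: lip_cst.
have Ls : \sum_(j < N) L (c j.+1) <= \sum_(j < N.+1) mean riesz_probability (c j).
  rewrite big_ord_recr/= -[leLHS]addr0 lerD ?ler_sum//.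
  by rewrite -(mc 0); apply: ml => //; exact: lip_cst.
rewrite [in mean _ f]fE mZ ?(functional_sum _ MP)//; last exact: lip_sum.
have i0 : 0 < (N.+1%:R^-1 : R) by rewrite invr_gt0.
have := ler_wpM2l (ltW i0) (lerD Lc0 Ls); rewrite [X in _ <= X]mulrDr mulr1.
by move/le_trans; apply; rewrite addrC lerD2l ltW.
Qed.

Lemma le_mean_riesz f : lip val f -> L f <= mean riesz_probability f.
Proof.
move=> lf; have [M M0 fM] := lip_bounded enorm_sphere lf.
have [LD LZ Lc _] := LP; have [mD mZ mc _] := positive_mean riesz_probability.
(* With this scaling [a * f x + 2^-1] takes values between 0 and 1. *)
pose a := (2 * M)^-1; have a0 : 0 < a by rewrite invr_gt0 mulr_gt0.
have := @le_mean_riesz01 (fun x => a * f x + 2^-1).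
rewrite LD ?LZ ?Lc ?mD ?mZ ?mc//; try exact: lipZ; try exact: lip_cst.
rewrite lerD2r ler_pM2l//; apply; first by apply: lipD (lipZ _ _) (lip_cst _ _).
move=> x; have := fM x; rewrite ler_norml => /andP[h1 h2].
have aM : a * M = 2^-1 by rewrite /a; field; exact: lt0r_neq0.
have : a * - M <= a * f x by rewrite ler_pM2l.
have : a * f x <= a * M by rewrite ler_pM2l.
by rewrite mulrN aM => ? ?; apply/andP; split; lra.
Qed.

Lemma mean_riesz f : lip val f -> mean riesz_probability f = L f.
Proof.
move=> lf; apply/eqP; rewrite eq_le le_mean_riesz// andbT.
have := le_mean_riesz (lipZ (-1) lf).
have [_ LZ _ _] := LP; have [_ mZ _ _] := positive_mean riesz_probability.
by rewrite LZ// mZ//; lra.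
Qed.

End riesz.

(** * Stationary measures *)

Section determining.
Context {R : realType} {n : nat}.
Local Notation S := (sphere R n).
Implicit Types (nu : probability S R) (U : set S).

Lemma setdist_open_gt0 U x : open U -> U x -> 0 < setdist val U x.
Proof. by move=> /sphere_openP oU /oU[r r0 rU]; exact: setdist_gt0 r0 rU. Qed.

(** The sets [V k] increase to [U], and the [k]-th Urysohn function equals 1 on [V k] while staying
    below the indicator of [U]; its common mean separates [nu1 (V k)] from [nu2 U]. *)
Lemma probability_le_open nu1 nu2 U :
  (forall f : S -> R, lip val f -> mean nu1 f = mean nu2 f) -> open U ->
  (nu1 U <= nu2 U)%E.
Proof.
move=> mE oU; have mU := open_measurable_sphere oU.
pose V k : set S := [set x : S | 1 < k%:R * setdist val U x].
have oV k : open (V k).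
  by apply: open_lip_gt; apply: lipZ; exists 1; exact: klip_setdist.
have mV k : measurable (V k) by exact: open_measurable_sphere.
have UE : U = \bigcup_k V k.
  apply/seteqP; split=> [x Ux|x [k _]].
    have [k kd] := ltr_add_invr (setdist_open_gt0 oU Ux); rewrite add0r in kd.
    by exists k.+1 => //; rewrite /V /= -ltr_pdivrMl// mulr1.
  apply: contraPP => Ux; rewrite /V /= setdist0// mulr0; lra.
have Vle k : (nu1 (V k) <= nu2 U)%E.
  pose f (x : S) := Num.min 1 (k%:R * setdist val U x).
  have [lf f0 fU] : below U f := below_setdist U (ler0n R k).
  apply: (@le_trans _ _ (mean nu2 f)%:E).
    rewrite -mE// -[leLHS]mul1e; apply: measure_le_mean => //.
      exact: bounded_meas_lip.
    by move=> x /ltW; rewrite /f le_min lexx.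
  by apply: mean_le_measure => //; exact: bounded_meas_lip.
have cvgV : (nu1 \o V) k @[k --> \oo] --> nu1 U.
  rewrite UE; apply: nondecreasing_cvg_mu => //.
    exact: bigcup_measurable.
  move=> i j ij; apply/subsetPset => x; rewrite /V /= => /lt_le_trans; apply.
  by rewrite ler_wpM2r ?setdist_ge0// ler_nat.
rewrite -(cvg_lim _ cvgV)//; apply: lime_le; last exact: nearW.
by apply/cvg_ex; exists (nu1 U).
Qed.

Lemma probability_lip_unique nu1 nu2 :
  (forall f : S -> R, lip val f -> mean nu1 f = mean nu2 f) ->
  forall A, measurable A -> nu1 A = nu2 A.
Proof.
move=> mE A mA; apply: (measure_unique (@open S) (fun=> setT)) => //.
- by move=> U V; exact: openI.
- by move=> _; exact: openT.
- by rewrite bigcup_const.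
- move=> U oU; apply/eqP; rewrite eq_le probability_le_open//=.
  by apply: probability_le_open => // f lf; rewrite mE.
- by move=> _; rewrite (le_lt_trans (probability_le1 nu1 measurableT))// ltry.
Qed.

End determining.

Unset Implicit Arguments.

Theorem theorem2 (R : realType) (n : nat)
    (mu : probability (sphere R n) R) (G : set (sphere R n)) :
  regular_measure mu ->
  is_support mu G ->
  unit_sphere R n `<=` \bigcup_(u in G) halfspace (val u) ->
  @orthogonal_mx R n.+1 `<=`
    closure (generated_subgroup [set refl_mx (val u) | u in G]) ->
  exists rho : probability (sphere R n) R,
    [/\ regular_measure rho,
        (forall A, measurable A -> T_push mu rho A = rho A),
        is_support rho [set: sphere R n] &
        forall rho' : probability (sphere R n) R,
          regular_measure rho' ->
          (forall A, measurable A -> T_push mu rho' A = rho' A) ->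
          forall A, measurable A -> rho' A = rho A].
Proof.
move=> _ [_ _ Gmin] coverG denseG.
have suppG u (U : set (sphere R n)) : G u -> open U -> U u -> (0 < mu U)%E.
  (* If [mu U] were 0, the complement of [U] would be a closed set of full measure, hence contain
     [G]. *)
  move=> Gu oU Uu; rewrite lt_def measure_ge0 andbT; apply/eqP => mU0.
  by apply: (Gmin _ (open_closedC oU) _ u Gu Uu); rewrite setCK.
have LP := positive_fold_mean suppG denseG coverG.
have rhoE f : lip val f -> mean (riesz_probability LP) f = fold_mean mu f.
  exact: mean_riesz.
have lw f : lip val f -> lip val (walk mu (sfold (R := R) (n := n)) f).
  exact: (lip_walk mu sfold_eucdist sfold_eucdist_dir).
exists (riesz_probability LP); split.
- exact: regular_riesz.
(* [T_push] of the Riesz measure is realised as a probability [nu]; the invariance of [fold_mean]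
   under the walk gives both measures the same Lipschitz means. *)
- have [nu nuE] := ex_mixture mu (riesz_probability LP) measurable_sfold.
  move=> A mA; rewrite -[LHS]nuE; apply: probability_lip_unique mA => f lf.
  rewrite (mean_T_push (fun A _ => nuE A) lf) (rhoE _ (lw _ lf)) (rhoE _ lf).
  by rewrite (fold_mean_walk suppG denseG coverG lf); lra.
- split; [exact: closedT|by rewrite setCT measure0|].
  move=> F cF F0 x _.
  (* A Urysohn function of the complement of [F], positive at [x], would have a mean that is
     positive yet bounded by the null measure of that complement. *)
  apply: contrapT => Fx; have oF : open (~` F) by exact: closed_openC.
  pose f (y : sphere R n) := Num.min 1 (1 * setdist val (~` F) y).
  have [lf f0 fF] : below (~` F) f := below_setdist (~` F) (@ler01 R).
  have := mean_le_measure (riesz_probability LP) (bounded_meas_lip lf)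
    (open_measurable_sphere oF) fF f0.
  rewrite F0 lee_fin rhoE// leNgt => /negP; apply.
  apply: (fold_mean_gt0 suppG denseG coverG (x := x)) => //.
  by rewrite /f lt_min ltr01 mul1r setdist_open_gt0.
- move=> rho' _ rhoT A mA; apply: probability_lip_unique mA => f lf.
  by rewrite rhoE// (stationary_mean suppG denseG coverG rhoT lf).
Qed.
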